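(* Let $U\in \mathrm{BV}(\Omega_T)$ be a weak solution of the initial boundary value problem for the Euler equations with boundary data $g$, let $U_h\in\mathcal V_h^0$ be a solution of the first or higher order finite volume scheme, and let $J$ be the functional with weights $\psi,\psi_\Gamma$ (all as defined in the context). Let $\bar A=(\bar A_1,\dots,\bar A_d)$ be the averaged Jacobian $$\bar A := \int_0^1 \mathrm{D}f\bigl(U_h+\tau(U-U_h)\bigr)\,d\tau,\qquad\text{i.e. } \bar A_k=\int_0^1 \mathrm{D}f_k\bigl(U_h+\tau(U-U_h)\bigr)\,d\tau ,$$ and let $\bar P_\pm$ be the corresponding projection matrices on $\Gamma_T$. Suppose $\varphi\in\mathcal V$ solves the adjoint problem $$\partial_t\varphi+\bar A^{\mathrm T}\nabla\varphi=\psi\quad\text{in }\Omega_T,\qquad \bar P_+^{\mathrm T}(\varphi-\psi_\Gamma)=0\quad\text{on }\Gamma_T .$$ Define $$\varepsilon_J:=J(U)-J(U_h),$$ $$\varepsilon_\Gamma^-:=-\bigl((P_-(U^+)-P_-(U_h^+))\,g,\ \varphi\bigr)_{\Gamma_T},$$ $$\varepsilon_\Gamma^+:=-\bigl(P_+(U^+)\mathbf f_\nu(U^+)-P_+(U_h^+)\mathbf f_\nu(U_h^+),\ \varphi-\psi_\Gamma\bigr)_{\Gamma_T}.$$ Then $$\varepsilon_J+\varepsilon_\Gamma^-+\varepsilon_\Gamma^+=\eta ,$$ where, for all $\varphi_h\in\mathcal V_h^0$, $$\eta:=N(U_h,\varphi)=N(U_h,\varphi-\varphi_h).$$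
   Context: **Continuous problem.** $\Omega\subset\mathbb R^d$ is the spatial domain, $T>0$, $\Omega_T=\Omega\times[0,T)$, and $\Gamma_T=\partial\Omega_T$ is the full space-time boundary, with space-time outward unit normal $\nu$. The unknown is $U=(\varrho,\varrho v,\varrho E)^{\mathrm T}$ with values in $\mathbb R^{d+2}$. The flux $f=(f_1,\dots,f_d)$, with $f_k(U)\in\mathbb R^{d+2}$ the flux in the $k$-th coordinate direction, is the Euler flux $f(U)=(\varrho v,\ \varrho vv^{\mathrm T}+pI,\ v(\varrho E+p))^{\mathrm T}$ with $p=\varrho(E-\tfrac12 v^2)(\gamma-1)$, $\gamma=1.4$. For $\mathbb R^{d+2}$-valued $\varphi$ we write $f(U)\nabla\varphi=\sum_k f_k(U)\cdot\partial_{x_k}\varphi$ and, for a tuple of matrices $A=(A_1,\dots,A_d)$, $A^{\mathrm T}\nabla\varphi=\sum_k A_k^{\mathrm T}\partial_{x_k}\varphi$. $(\cdot,\cdot)_S$ denotes the integral over $S$ of the Euclidean inner product. All traces and integrals that appear are understood to be well defined. The space-time flux is $\mathbf f(U)=(f(U),U)$ and $\mathbf f_\nu(U)=\mathbf f(U)\cdot\nu$. A superscript $+$ denotes the interior trace on a boundary. **Projections.** For a real diagonalizable matrix $A=R\Lambda L$ with $L=R^{-1}$, $\Lambda=\mathrm{diag}(\lambda_i)$, set $P_\pm(A)=R\,\mathrm{diag}(\chi^\pm(\lambda_i))\,L$ with $\chi^\pm(\lambda)=\max(0,\mathrm{sign}(\pm\lambda))$. At a point of $\Gamma_T$ with normal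 $\nu$, $P_\pm(U):=P_\pm(\mathbf f_\nu'(U))$. For a tuple $\bar A=(\bar A_1,\dots,\bar A_d)$, the corresponding projections $\bar P_\pm$ on $\Gamma_T$ are $P_\pm$ of $\sum_k n_k\bar A_k$ if $\nu=(n,0)$ and of $\pm I$ if $\nu=(0,\pm1)$. The matrices to which $P_\pm$ is applied are assumed diagonalizable. **Weak solution.** $\mathcal V=\{\varphi\in W^{1,\infty}(\Omega_T):\ \mathrm{supp}\,\varphi\subset\subset\overline{\Omega_T}\}$ (test functions may take nonzero boundary values). $U\in\mathrm{BV}(\Omega_T)$ is a weak solution of $U_t+\nabla\cdot f(U)=0$ in $\Omega_T$, $P_-(U^+)(\mathbf f_\nu(U^+)-g)=0$ on $\Gamma_T$, if for all $\varphi\in\mathcal V$ $$(U,\varphi_t)_{\Omega_T}+(f(U),\nabla\varphi)_{\Omega_T}-(P_+(U^+)\mathbf f_\nu(U^+),\varphi)_{\Gamma_T}=(P_-(U^+)g,\varphi)_{\Gamma_T}.$$ **Grid.** $\overline\Omega$ is the union of the closures of open cells $V_i$; the closures of two different cells meet in the empty set or a union of common faces and vertices. $\Gamma_{ij}$ are the faces of $V_i$, with outer normal $n_{ij}$, and $\sum_j|\Gamma_{ij}|n_{ij}=0$ for every $i$. Let $0=t_0<\dots<t_N=T$, $I_m=[t_{m-1},t_m]$, $\Delta t_m=t_m-t_{m-1}$, $V_i^m=V_i\times I_m$, $\Gamma_{ij}^m=\Gamma_{ij}\times I_m$. $\mathcal V_h^0$ is the space of functions constant on each $V_i^m$, and $\mathcal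 V_h$ the space of functions that are Lipschitz continuous on each $V_i^m$. $U_h\in\mathcal V_h^0$ is identified with its values $U_i^m$; on a boundary face of $V_i^m$ its trace is $U_h^+=U_i^m$. $U_i^0$ are the initial cell averages. **Numerical fluxes.** On an interior face, $F_{ij}^m=F_{\mathrm{riem}}(U_i^m,U_j^m,n_{ij})$ is a conservative numerical flux (Riemann solver) consistent with the normal flux $f\cdot n_{ij}$ (for higher order schemes it may depend on a larger stencil of cell averages). On a boundary face $\Gamma_{ij}^m\subset\Gamma_T$, $F_{ij}^m=P_+(U_i^m)\mathbf f_{\nu_{ij}}(U_i^m)+P_-(U_i^m)\,g_{ij}^m$, where $g_{ij}^m$ is the average of $g$ over $\Gamma_{ij}^m$. For a fixed $\theta\in[0,1]$ the space-time numerical flux is $$\mathcal F_\nu^m(U_h)=\begin{cases}F_{ij}^m & \text{on interior and on boundary faces }\Gamma_{ij}^m,\ \nu=(n_{ij},0),\\ (1-\theta)U_i^{m-1}+\theta U_i^m & \text{on }V_i\times\{t_m\},\ \nu=(0,1),\ m\ge1,\\ U_i^0 & \text{on }V_i\times\{t_0\},\ \nu=(0,1),\ m=0.\end{cases}$$ On the bottom face $V_i\times\{t_{m-1}\}$ of $V_i^m$, with outward normal $(0,-1)$, the flux is minus the time flux of level $m-1$. Different values of $\theta$ correspond to different time discretizations, e.g. explicit Euler for $\theta=0$ and implicit Euler for $\theta=1$. **Variational form.** For $\varphi\in\mathcal V_h$, $$N(U_h,\varphi)=\sum_{i,m}(\mathcal F_\nu^m(U_h),\varphi)_{\partial V_i^m}-\sum_{i,m}\bigl((U_h,\varphi_t)_{V_i^m}+(f(U_h),\nabla\varphi)_{V_i^m}\bigr),$$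 the sums running over all space-time cells. **Scheme.** The first or higher order finite volume scheme (with implicit Euler time discretization) is $U_i^m+\frac{\Delta t_m}{|V_i|}\sum_j|\Gamma_{ij}|F_{ij}^m=U_i^{m-1}$, $m\ge1$; it is rewritten as the Galerkin method: find $U_h\in\mathcal V_h^0$ such that $N(U_h,\varphi_h)=0$ for all $\varphi_h\in\mathcal V_h^0$, and a solution $U_h$ of the scheme is understood to satisfy this Galerkin orthogonality. **Functional.** $J(U)=(U,\psi)_{\Omega_T}-(P_+(U^+)\mathbf f_\nu(U^+),\psi_\Gamma)_{\Gamma_T}$, with weights $\psi$ on $\Omega_T$ and $\psi_\Gamma$ on $\Gamma_T$.
   Formalization: The identity is false for general g, since N uses averages of g (and U_i^0) while ε_Γ^- uses g itself; it is proved with the extra term (P_-(U_h^+)(g−g_h),φ) on Γ_T for all g, and as stated when g equals its averages. *)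

(* Defs.v *)
From HB Require Import structures.
From mathcomp Require Import all_boot all_order all_algebra.
From mathcomp Require Import all_classical all_reals all_analysis.

Set Implicit Arguments.
Unset Strict Implicit.
Unset Printing Implicit Defensive.

Import Order.TTheory GRing.Theory Num.Theory.
Import numFieldNormedType.Exports.

Local Open Scope classical_set_scope.
Local Open Scope ring_scope.

(* The type [T] with the sigma-algebra of all its subsets: [mu_ext] of a gauge
   on [powerset_type T] is the infimum over all countable covers. *)
Definition powerset_type (T : Type) : Type := T.
Definition powerset_display : measure_display.
Proof. exact. Qed.

HB.instance Definition _ (T : pointedType) := Pointed.on (powerset_type T).
HB.instance Definition _ (T : pointedType) :=
  @isMeasurable.Build powerset_display (powerset_type T)
    setT I (fun _ _ => I) (fun _ _ => I).

Section CoverOuterMeasure.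
Context {R : realType} {T : pointedType}.

Definition cover_gauge (tau : set T -> \bar R) (A : set T) : \bar R :=
  if `[< A = set0 >] then 0%E else maxe 0%E (tau A).

Lemma cover_gauge0 tau : cover_gauge tau set0 = 0%E.
Proof. by rewrite /cover_gauge; case: asboolP. Qed.

Lemma cover_gauge_ge0 tau A : (0 <= cover_gauge tau A)%E.
Proof. by rewrite /cover_gauge; case: ifP => // _; rewrite le_max lexx. Qed.

Definition cover_measure (tau : set T -> \bar R) (A : set T) : \bar R :=
  @mu_ext _ (powerset_type T) R (cover_gauge tau) A.

Lemma cover_measure0 tau : cover_measure tau set0 = 0%E.
Proof.
exact: (@mu_ext0 _ (powerset_type T) R _ (cover_gauge0 tau)
  (cover_gauge_ge0 tau)).
Qed.

Lemma cover_measure_ge0 tau A : (0 <= cover_measure tau A)%E.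
Proof.
exact: (@mu_ext_ge0 _ (powerset_type T) R _ (cover_gauge_ge0 tau)).
Qed.

Lemma le_cover_measure tau :
  {homo cover_measure tau : A B / A `<=` B >-> (A <= B)%E}.
Proof. exact: (@le_mu_ext _ (powerset_type T)). Qed.

Lemma cover_measure_subadditive tau : sigma_subadditive (cover_measure tau).
Proof.
exact: (@mu_ext_sigma_subadditive _ (powerset_type T) R _
  (cover_gauge_ge0 tau)).
Qed.

End CoverOuterMeasure.

Section EuclideanMeasures.
Context {R : realType} {d : nat}.
Implicit Types (A : set 'rV[R]_d) (x y : 'rV[R]_d).

Definition dotr x y : R := \sum_k x 0 k * y 0 k.
Definition enorm x : R := Num.sqrt (dotr x x).

Definition ediam A : \bar R :=
  ereal_sup [set r | exists x y, [/\ A x, A y & r = (enorm (x - y))%:E]].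

Definition box_volume A : \bar R :=
  ereal_inf [set r | exists a b : 'rV[R]_d,
    [/\ forall k, a 0 k <= b 0 k,
        A `<=` [set x | forall k, a 0 k <= x 0 k <= b 0 k]
      & r = (\prod_k (b 0 k - a 0 k))%:E]].

Definition lebesgue_outer : set 'rV[R]_d -> \bar R := cover_measure box_volume.

HB.instance Definition _ := isOuterMeasure.Build R 'rV[R]_d lebesgue_outer
  (cover_measure0 _) (cover_measure_ge0 _) (@le_cover_measure _ _ _)
  (@cover_measure_subadditive _ _ _).

(* Volume of the unit ball of R^s: it normalizes the Hausdorff measure of
   dimension s so that it is the surface area on flat pieces. *)
Fixpoint ball_volume (s : nat) : R :=
  if s is s1.+1 then
    if s1 is s2.+1 then 2 * pi / s%:R * ball_volume s2 else 2
  else 1.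

Definition hausdorff_gauge (s : nat) (e : R) A : \bar R :=
  if (ediam A <= e%:E)%E
  then (ball_volume s * (fine (ediam A) / 2) ^+ s)%:E else +oo%E.

Definition hausdorff_outer (s : nat) A : \bar R :=
  ereal_sup [set cover_measure (hausdorff_gauge s e) A | e in [set e : R | 0 < e]].

Lemma hausdorff_outer0 s : hausdorff_outer s set0 = 0%E.
Proof.
rewrite /hausdorff_outer (_ : image _ _ = [set 0%E]) ?ereal_sup1//.
apply/seteqP; split=> [_ [e _ <-]|_ ->]; first by rewrite /= cover_measure0.
by exists 1; rewrite ?cover_measure0 //=.
Qed.

Lemma hausdorff_outer_ge0 s A : (0 <= hausdorff_outer s A)%E.
Proof.
apply: (@le_trans _ _ (cover_measure (hausdorff_gauge s 1) A)).
  exact: cover_measure_ge0.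
by apply: ereal_sup_ubound; exists 1 => //=.
Qed.

Lemma le_hausdorff_outer s :
  {homo hausdorff_outer s : A B / A `<=` B >-> (A <= B)%E}.
Proof.
move=> A B AB; apply: ge_ereal_sup => _ [e e0 <-].
apply: (le_trans (le_cover_measure _ AB)).
by apply: ereal_sup_ubound; exists e.
Qed.

Lemma hausdorff_outer_subadditive s : sigma_subadditive (hausdorff_outer s).
Proof.
move=> F; apply: ge_ereal_sup => _ [e e0 <-].
apply: (le_trans (cover_measure_subadditive _ _)).
apply: lee_nneseries => [i _ _|i _]; first exact: cover_measure_ge0.
by apply: ereal_sup_ubound; exists e.
Qed.

HB.instance Definition _ s := isOuterMeasure.Build R 'rV[R]_d
  (hausdorff_outer s) (hausdorff_outer0 s) (hausdorff_outer_ge0 s)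
  (@le_hausdorff_outer s) (@hausdorff_outer_subadditive s).

End EuclideanMeasures.

Definition integral_ok {disp} {X : measurableType disp} {R : realType}
    (mu : {measure set X -> \bar R}) (D : set X) (f : X -> R) : Prop :=
  measurable D /\ mu.-integrable D (EFin \o f).

Section EulerFlux.
Context {R : realType} {d : nat}.

(* Conserved variables (rho, rho v, rho E) stacked as a column of blocks. *)
Definition state := 'cV[R]_(1 + (d + 1)).
Implicit Types (u v : state) (k : 'I_d).

Definition dots u v : R := \sum_i u i 0 * v i 0.

Definition density u : R := usubmx u 0 0.
Definition velocity u k : R := usubmx (dsubmx u) k 0 / density u.
Definition energy u : R := dsubmx (dsubmx u) 0 0 / density u.
Definition gamma : R := 7 / 5.
Definition pressure u : R :=
  density u * (energy u - 2^-1 * \sum_k velocity u k ^+ 2) * (gamma - 1).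

Definition flux k u : state :=
  col_mx (density u * velocity u k)%:M
    (col_mx (\col_l (density u * velocity u l * velocity u k
                     + (l == k)%:R * pressure u))
            (velocity u k * (density u * energy u + pressure u))%:M).

Definition jac (F : state -> state) u : 'M[R]_(1 + (d + 1)) :=
  \matrix_(i, j) ('D_(delta_mx j 0) F u) i 0.

(* Space-time normals are pairs (n, nt) in R^d x R. *)
Definition stflux (nu : 'rV[R]_d * R) u : state :=
  \sum_k nu.1 0 k *: flux k u + nu.2 *: u.

Definition avg_jac k u v : 'M[R]_(1 + (d + 1)) :=
  \matrix_(i, j) \int[lebesgue_measure]_(tau in `[0, 1])
     jac (flux k) (v + tau *: (u - v)) i j.

Definition avg_normal_jac (nu : 'rV[R]_d * R) u v : 'M[R]_(1 + (d + 1)) :=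
  \sum_k nu.1 0 k *: avg_jac k u v + nu.2%:M.

End EulerFlux.
Arguments state : clear implicits.

Section SpectralProjections.
Context {R : realType} {n : nat}.

(* For diagonalizable A = Q diag(l) Q^-1 the matrix Q diag(chi l) Q^-1 does not
   depend on the diagonalization, so that [xget] has a unique candidate; for
   other matrices the value is the default 0. *)
Definition spectral_map (chi : R -> R) (A : 'M[R]_n) : 'M[R]_n :=
  xget 0 [set P | exists Q : 'M[R]_n, exists l : 'rV[R]_n,
    [/\ Q \in unitmx, A = Q *m diag_mx l *m invmx Q
      & P = Q *m diag_mx (map_mx chi l) *m invmx Q]].

Definition Pplus : 'M[R]_n -> 'M[R]_n :=
  spectral_map (fun l => Num.max 0 (Num.sg l)).
Definition Pminus : 'M[R]_n -> 'M[R]_n :=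
  spectral_map (fun l => Num.max 0 (Num.sg (- l))).

End SpectralProjections.

Section Upwind.
Context {R : realType} {d : nat}.
Implicit Types (nu : 'rV[R]_d * R) (u : state R d).

Definition Pp nu u := Pplus (jac (stflux nu) u).
Definition Pm nu u := Pminus (jac (stflux nu) u).
Definition outflow nu u : state R d := Pp nu u *m stflux nu u.

End Upwind.

Section SpaceTime.
Context {R : realType} {d : nat}.
Local Notation E := 'rV[R]_d.
Local Notation X := ('rV[R]_d * R)%type.
Local Notation S := (state R d).

Definition lebesgue_om : {outer_measure set E -> \bar R} :=
  @lebesgue_outer R d.
Definition hausdorff_om : {outer_measure set E -> \bar R} :=
  @hausdorff_outer R d d.-1.

(* Lebesgue measure and surface measure, on their Caratheodory-measurable
   sets. *)
Definition leb : {measure set (caratheodory_type lebesgue_om) -> \bar R} :=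
  lebesgue_om.
Definition surf : {measure set (caratheodory_type hausdorff_om) -> \bar R} :=
  hausdorff_om.

Definition stvol :
  {measure set (caratheodory_type lebesgue_om * measurableTypeR R) -> \bar R} :=
  (leb \x @lebesgue_measure R)%E.
Definition stsurf :
  {measure set (caratheodory_type hausdorff_om * measurableTypeR R) -> \bar R} :=
  (surf \x @lebesgue_measure R)%E.

Definition dirx (k : 'I_d) : X := (delta_mx 0 k, 0).
Definition dirt : X := (0, 1).
Definition stdir (v : X) : Prop := v = dirt \/ exists k, v = dirx k.

Definition flux_grad (u : S) (phi : X -> S) (p : X) : R :=
  \sum_k dots (flux k u) ('D_(dirx k) phi p).

Definition bdry (A : set E) : set E := closure A `\` A°.

Section Domain.
Variables (Omega : set E) (T : R) (n : E -> E).

Definition cyl : set X := Omega `*` `[0, T[.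
Definition lateral : set X := bdry Omega `*` `[0, T].

(* Integrands on the space-time boundary depend on the point and on the outward
   normal, which is (n x, 0) on the lateral part, (0, 1) on top and (0, -1) at
   the bottom. *)
Definition bd_int (h : X -> X -> R) : R :=
  \int[stsurf]_(p in lateral) h p (n p.1, 0)
  + \int[leb]_(x in Omega) h (x, T) (0, 1)
  + \int[leb]_(x in Omega) h (x, 0) (0, -1).

Definition bd_int_ok (h : X -> X -> R) : Prop :=
  [/\ integral_ok stsurf lateral (fun p => h p (n p.1, 0)),
      integral_ok leb Omega (fun x => h (x, T) (0, 1))
    & integral_ok leb Omega (fun x => h (x, 0) (0, -1))].

Definition bd_ae (Q : X -> X -> Prop) : Prop :=
  [/\ {ae stsurf, forall p, lateral p -> Q p (n p.1, 0)},
      {ae leb, forall x, Omega x -> Q (x, T) (0, 1)}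
    & {ae leb, forall x, Omega x -> Q (x, 0) (0, -1)}].

Definition cyl_int (h : X -> R) : R := \int[stvol]_(p in cyl) h p.
Definition cyl_int_ok (h : X -> R) : Prop := integral_ok stvol cyl h.
Definition cyl_ae (Q : X -> Prop) : Prop :=
  {ae stvol, forall p, cyl p -> Q p}.

Definition iter_derive (vs : seq X) (chi : X -> R) : X -> R :=
  foldr (fun v (h : X -> R) => 'D_v h : X -> R) chi vs.

Definition bump (chi : X -> R) : Prop :=
  [/\ forall vs, continuous (iter_derive vs chi),
      forall vs v p, derivable (iter_derive vs chi) p v
    & exists K, [/\ compact K, K `<=` Omega `*` `]0, T[
                  & forall p, ~ K p -> chi p = 0]].

Definition bounded_variation (U : X -> S) : Prop := forall i,
  cyl_int_ok (fun p => U p i 0) /\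
  exists C : R, forall (chi : 'I_d -> X -> R) (chit : X -> R),
    (forall k, bump (chi k)) -> bump chit ->
    (forall p, \sum_k chi k p ^+ 2 + chit p ^+ 2 <= 1) ->
    cyl_int (fun p => U p i 0 *
      (\sum_k 'D_(dirx k) (chi k) p + 'D_dirt chit p)) <= C.

Definition interior_trace (U Up : X -> S) : Prop :=
  bd_ae (fun p _ =>
    (fun r : R => (r ^+ d.+1)^-1 *
       \int[stvol]_(q in cyl `&` ball p r) \sum_i `|U q i 0 - Up p i 0|)
      @ 0^'+ --> (0 : R)).

(* Membership in W^{1,oo}(Omega_T) of the continuous representative: its weak
   partial derivatives are the pointwise ones, which exist almost everywhere by
   Rademacher's theorem. Hence derivatives of test functions are written 'D_v. *)
Definition W1oo (phi : X -> S) : Prop :=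
  [/\ {within closure cyl, continuous phi},
      exists C : R, forall p, cyl p -> `|phi p| <= C
    & forall v, stdir v ->
        (exists C : R, cyl_ae (fun p => derivable phi p v /\
                                        `|'D_v phi p| <= C)) /\
        (forall chi, bump chi -> forall i,
           cyl_int (fun p => phi p i 0 * 'D_v chi p)
           = - cyl_int (fun p => ('D_v phi p) i 0 * chi p))].

Definition test_space (phi : X -> S) : Prop :=
  W1oo phi /\ compact (closure [set p | closure cyl p /\ phi p != 0]).

Definition weak_solution (U Up g : X -> S) : Prop :=
  [/\ bounded_variation U, interior_trace U Up
    & forall phi, test_space phi ->
      [/\ cyl_int_ok (fun p => dots (U p) ('D_dirt phi p)),
          cyl_int_ok (fun p => flux_grad (U p) phi p),
          bd_int_ok (fun p nu => dots (outflow nu (Up p)) (phi p)),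
          bd_int_ok (fun p nu => dots (Pm nu (Up p) *m g p) (phi p))
        & cyl_int (fun p => dots (U p) ('D_dirt phi p))
          + cyl_int (fun p => flux_grad (U p) phi p)
          - bd_int (fun p nu => dots (outflow nu (Up p)) (phi p))
          = bd_int (fun p nu => dots (Pm nu (Up p) *m g p) (phi p))]].

Definition adjoint_solution (U Up V Vp psi psiG phi : X -> S) : Prop :=
  cyl_ae (fun p =>
    'D_dirt phi p + \sum_k (avg_jac k (U p) (V p))^T *m 'D_(dirx k) phi p
    = psi p) /\
  bd_ae (fun p nu =>
    (Pplus (avg_normal_jac nu (Up p) (Vp p)))^T *m (phi p - psiG p) = 0).

(* The functional takes a function and its trace on the boundary. *)
Definition functional (psi psiG U Up : X -> S) : R :=
  cyl_int (fun p => dots (U p) (psi p))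
  - bd_int (fun p nu => dots (outflow nu (Up p)) (psiG p)).

Definition functional_ok (psi psiG U Up : X -> S) : Prop :=
  cyl_int_ok (fun p => dots (U p) (psi p)) /\
  bd_int_ok (fun p nu => dots (outflow nu (Up p)) (psiG p)).

Definition err_minus_density (Up Vp g phi : X -> S) (p nu : X) : R :=
  dots ((Pm nu (Up p) - Pm nu (Vp p)) *m g p) (phi p).
Definition err_plus_density (Up Vp phi psiG : X -> S) (p nu : X) : R :=
  dots (outflow nu (Up p) - outflow nu (Vp p)) (phi p - psiG p).

Definition admissible (U Up : X -> S) : Prop :=
  cyl_ae (fun p => 0 < density (U p)) /\ bd_ae (fun p _ => 0 < density (Up p)).

Definition diagonalizable_normals (Up Vp : X -> S) : Prop :=
  bd_ae (fun p nu =>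
    [/\ diagonalizable (jac (stflux nu) (Up p)),
        diagonalizable (jac (stflux nu) (Vp p))
      & diagonalizable (avg_normal_jac nu (Up p) (Vp p))]).

End Domain.

Record mesh := Mesh {
  cell : finType;
  face : finType;
  cell_set : cell -> set E;
  face_set : face -> set E;
  inc : cell -> face -> bool;
  nrm : cell -> face -> E;
  lvl : nat;
  tm : nat -> R }.

Definition is_bdry_face (M : mesh) (e : face M) : bool :=
  #|[pred i | inc i e]| == 1%N.

Record is_mesh (Omega : set E) (T : R) (M : mesh) : Prop := {
  mesh_open : forall i : cell M, open (cell_set i);
  mesh_sub : forall i : cell M, cell_set i `<=` Omega;
  mesh_vol : forall i : cell M, (0 < leb (cell_set i) < +oo)%E;
  mesh_disj : forall i j : cell M, i != j -> cell_set i `&` cell_set j = set0;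
  mesh_cover : closure Omega = \bigcup_(i : cell M) closure (cell_set i);
  mesh_bdry : forall i : cell M,
    bdry (cell_set i) = \bigcup_(e in [set e | inc i e]) face_set e;
  mesh_bdryT :
    bdry Omega = \bigcup_(e in [set e : face M | is_bdry_face e]) face_set e;
  mesh_inc : forall e : face M, (0 < #|[pred i | inc i e]| <= 2)%N;
  (* vertices, and edges for d >= 3, are negligible for the surface measure *)
  mesh_meet : forall i j : cell M, i != j ->
    surf ((closure (cell_set i) `&` closure (cell_set j))
          `\` \bigcup_(e in [set e | inc i e && inc j e]) face_set e) = 0%E;
  mesh_face_meet : forall e e' : face M, e != e' ->
    surf (face_set e `&` face_set e') = 0%E;
  mesh_face_fin : forall e : face M, (surf (face_set e) < +oo)%E;
  mesh_face_null : forall e : face M, leb (face_set e) = 0%E;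
  mesh_nrm1 : forall (i : cell M) e, inc i e -> enorm (nrm i e) = 1;
  mesh_flat : forall (i : cell M) e, inc i e ->
    forall x y, face_set e x -> face_set e y -> dotr (x - y) (nrm i e) = 0;
  mesh_outward : forall (i : cell M) e, inc i e ->
    {ae surf, forall x, face_set e x -> exists2 r : R, 0 < r & forall s, 0 < s < r ->
      cell_set i (x - s *: nrm i e) /\ ~ cell_set i (x + s *: nrm i e)};
  mesh_opp : forall (i j : cell M) e, i != j -> inc i e -> inc j e ->
    nrm j e = - nrm i e;
  mesh_closed : forall i : cell M,
    \sum_(e | inc i e) fine (surf (face_set e)) *: nrm i e = 0;
  mesh_lvl : (0 < lvl M)%N;
  mesh_t0 : tm M 0 = 0;
  mesh_tN : tm M (lvl M) = T;
  mesh_tlt : forall m, (m < lvl M)%N -> tm M m < tm M m.+1 }.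

Section Scheme.
Variable M : mesh.
Implicit Types (i j : cell M) (e : face M) (m : nat).

Definition slab m : set R := `[tm M m.-1, tm M m].
Definition dt m : R := tm M m - tm M m.-1.
Definition vol i : R := fine (leb (cell_set i)).
Definition area e : R := fine (surf (face_set e)).

Definition bdry_normal (x : E) : E :=
  if [pick ie : cell M * face M |
        [&& is_bdry_face ie.2, inc ie.1 ie.2 & `[< face_set ie.2 x >]]] is Some ie
  then nrm ie.1 ie.2 else 0.

(* The values U_i^m, with m = 0 for the initial averages. *)
Definition gridfun := cell M -> nat -> S.

(* A point of the closure of a single space-time cell gets the value of this
   cell. This determines the function almost everywhere in the cylinder and its
   interior trace almost everywhere on the space-time boundary. *)
Definition gridfun_val (W : gridfun) (p : X) : S :=
  if [pick im : cell M * 'I_(lvl M) |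
        `[< closure (cell_set im.1) p.1 /\ slab im.2.+1 p.2 >]] is Some im
  then W im.1 im.2.+1 else 0.

(* F W m i e is the flux through the face e of the cell i at level m in the
   direction of the outward normal; depending on all of W it covers first order
   two-point fluxes and reconstructions on larger stencils. *)
Definition numflux := gridfun -> nat -> cell M -> face M -> S.

Definition conservative (F : numflux) : Prop :=
  forall W m i j e, i != j -> inc i e -> inc j e -> F W m i e = - F W m j e.

Definition consistent (F : numflux) : Prop :=
  forall (u : S) m i e, 0 < density u -> inc i e ->
    F (fun _ _ => u) m i e = stflux (nrm i e, 0) u.

Definition neighbour i e : cell M :=
  odflt i [pick j | (j != i) && inc j e].

Definition two_point_flux (Friem : S -> S -> E -> S) : numflux :=
  fun W m i e => Friem (W i m) (W (neighbour i e) m) (nrm i e).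

Definition face_avg (g : X -> S) e m : S :=
  \col_c ((fine (stsurf (face_set e `*` slab m)))^-1
          * \int[stsurf]_(p in face_set e `*` slab m) g p c 0).

Section Method.
Variables (F : numflux) (theta : R) (g : X -> S) (W : gridfun).

Definition face_flux m i e : S :=
  if is_bdry_face e
  then outflow (nrm i e, 0) (W i m)
       + Pm (nrm i e, 0) (W i m) *m face_avg g e m
  else F W m i e.

Definition time_flux m i : S :=
  if m is m'.+1 then (1 - theta) *: W i m' + theta *: W i m'.+1 else W i 0%N.

(* The bottom of the cylinder carries the datum g = f_nu(U_0) = - U_0. *)
Definition initial_averages : Prop := forall i,
  W i 0%N = - \col_c ((vol i)^-1 * \int[leb]_(x in cell_set i) g (x, 0) c 0).

Definition fv_scheme : Prop := forall i m, (0 < m <= lvl M)%N ->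
  W i m + (dt m / vol i) *: \sum_(e | inc i e) area e *: face_flux m i e
  = W i m.-1.

(* Elements of V_h may jump across faces: each space-time cell has its own
   function, whose values on the boundary of the cell are the traces. *)
Definition broken := cell M -> nat -> X -> S.

Definition cst_broken (c : gridfun) : broken := fun i m _ => c i m.

Definition Nform (phi : broken) : R :=
  \sum_i \sum_(1 <= m < (lvl M).+1)
    (\sum_(e | inc i e) \int[stsurf]_(p in face_set e `*` slab m)
                          dots (face_flux m i e) (phi i m p)
     + \int[leb]_(x in cell_set i) dots (time_flux m i) (phi i m (x, tm M m))
     + \int[leb]_(x in cell_set i) dots (- time_flux m.-1 i) (phi i m (x, tm M m.-1)))
  - \sum_i \sum_(1 <= m < (lvl M).+1)
    (\int[stvol]_(p in cell_set i `*` slab m) dots (W i m) ('D_dirt (phi i m) p)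
     + \int[stvol]_(p in cell_set i `*` slab m) flux_grad (W i m) (phi i m) p).

Definition Nform_ok (phi : broken) : Prop := forall i m, (0 < m <= lvl M)%N ->
  [/\ forall e, inc i e -> integral_ok stsurf (face_set e `*` slab m)
                             (fun p => dots (face_flux m i e) (phi i m p)),
      integral_ok leb (cell_set i)
        (fun x => dots (time_flux m i) (phi i m (x, tm M m))),
      integral_ok leb (cell_set i)
        (fun x => dots (- time_flux m.-1 i) (phi i m (x, tm M m.-1))),
      integral_ok stvol (cell_set i `*` slab m)
        (fun p => dots (W i m) ('D_dirt (phi i m) p))
    & integral_ok stvol (cell_set i `*` slab m)
        (fun p => flux_grad (W i m) (phi i m) p)].

Definition galerkin : Prop := forall c : gridfun, Nform (cst_broken c) = 0.

(* The scheme sees the data only through the averages g_h (which are - U_i^0 at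
   the bottom): the error equation is exact up to the data oscillation
   (P_-(U_h)(g - g_h), phi) on the space-time boundary, where P_- vanishes on
   the top. *)
Definition data_resolved : Prop :=
  (forall e m, is_bdry_face e -> (0 < m <= lvl M)%N ->
     {ae stsurf, forall p, (face_set e `*` slab m) p -> g p = face_avg g e m}) /\
  (forall i, {ae leb, forall x, cell_set i x -> g (x, 0) = - W i 0%N}).

Definition data_oscillation (phi : X -> S) : R :=
  \sum_i \sum_(1 <= m < (lvl M).+1) \sum_(e | is_bdry_face e && inc i e)
    \int[stsurf]_(p in face_set e `*` slab m)
      dots (Pm (nrm i e, 0) (W i m) *m (g p - face_avg g e m)) (phi p)
  + \sum_i \int[leb]_(x in cell_set i)
      dots (Pm (0, -1) (W i 1%N) *m (g (x, 0) + W i 0%N)) (phi (x, 0)).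

End Method.

Lemma two_point_flux_conservative Omega T (Friem : S -> S -> E -> S) :
    is_mesh Omega T M ->
    (forall u v n, Friem u v n = - Friem v u (- n)) ->
  conservative (two_point_flux Friem).
Proof.
move=> meshM Fopp W m.
have nbr i j e : i != j -> inc i e -> inc j e -> neighbour i e = j.
  move=> ij ie je; rewrite /neighbour.
  case: pickP => [k /andP[ki ke]|/(_ j)]; last by rewrite eq_sym ij je.
  apply/eqP; apply: contraT => kj.
  have := mesh_inc meshM e; rewrite leqNgt => /andP[_ /negP[]].
  have /subset_leq_card : [set i; j; k]%SET \subset [pred i | inc i e].
    by apply/fintype.subsetP => x; rewrite !inE => /orP[/orP[]|] /eqP->.
  rewrite -finset.setUA cardsU1 cards2 !inE negb_or ij.
  rewrite (eq_sym i k) ki (eq_sym j k) kj => k3; apply/negP.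
  by rewrite -ltnNge.
move=> i j e ij ie je; rewrite /two_point_flux (nbr i j)// (nbr j i) 1?eq_sym//.
by rewrite Fopp (mesh_opp meshM ij ie je).
Qed.

Lemma two_point_flux_consistent (Friem : S -> S -> E -> S) :
    (forall u n, 0 < density u -> Friem u u n = stflux (n, 0) u) ->
  consistent (two_point_flux Friem).
Proof. by move=> Fcons u m i e u0 _; exact: Fcons. Qed.

End Scheme.
End SpaceTime.

Arguments mesh : clear implicits.
Arguments bdry_normal {R d} M.

(* Main.v *)
Require Import Defs.
From mathcomp Require Import all_boot all_order all_algebra.
From mathcomp Require Import all_classical all_reals all_analysis.
From mathcomp Require Import ring.

Set Implicit Arguments.
Unset Strict Implicit.
Unset Printing Implicit Defensive.

Import Order.TTheory GRing.Theory Num.Theory.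
Import numFieldNormedType.Exports.

Local Open Scope classical_set_scope.
Local Open Scope ring_scope.

(** The averaged Jacobian turns the flux difference [f(U) - f(U_h)] into
    [Abar (U - U_h)], so the adjoint equation tested with [U - U_h] and the weak
    formulation of [U] express [J(U) - J(U_h)] through boundary integrals and
    the volume part of [N(U_h, phi)]. In [N(U_h, phi)] the fluxes through
    interior faces cancel and the time fluxes telescope, which leaves the same
    boundary integrals up to the oscillation of the data. *)

(** Nothing is linearized on the boundary. The densities of [eps_minus] and [eps_plus], together
    with the boundary part of the functional, add up point by point to the change of the boundary
    integrand when the trace of [U] is replaced by that of [Uh]. Only the volume terms use the
    averaged Jacobian. There the mean value identity needs a smooth flux along the whole segment
    from [Uh] to [U]; the Euler flux degenerates only at zero density, and positive density is a
    convex condition.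

    The rest of the work lies in cutting integrals into cells and faces. [gridfun_val] and
    [bdry_normal] are determined only off cell interfaces, face overlaps and time levels, so every
    decomposition holds up to a null set, and integrals have to be compared almost everywhere. The
    oscillation of the data is the part of a boundary piece that the scheme does not see: it is
    recovered as a difference of two integrable terms. *)

(** * Integrals cut into pieces up to null sets *)

Section Integration.
Context {disp} {X : measurableType disp} {R : realType}.
Variable mu : {measure set X -> \bar R}.
Implicit Types D : set X.

Lemma Rintegral_sum D (I : Type) (s : seq I) (P : pred I) (f : I -> X -> R) :
  measurable D -> (forall i, P i -> mu.-integrable D (EFin \o f i)) ->
  \int[mu]_(x in D) (\sum_(i <- s | P i) f i x)
  = \sum_(i <- s | P i) \int[mu]_(x in D) f i x.
Proof.
move=> mD fi; elim: s => [|i s IH].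
  under eq_Rintegral do rewrite big_nil.
  by rewrite big_nil Rintegral_cst// mul0r.
under eq_Rintegral do rewrite big_cons.
rewrite big_cons; case: ifPn => // Pi; rewrite RintegralD ?IH//; first exact: fi.
have := integrable_sum mD s fi.
by apply: eq_integrable => // x _; rewrite /= sumEFin.
Qed.

Lemma Rintegral_sumZr D (I : Type) (s : seq I) (f : I -> X -> R) (c : I -> R) :
  measurable D -> (forall i, mu.-integrable D (EFin \o f i)) ->
  \int[mu]_(x in D) (\sum_(i <- s) f i x * c i)
  = \sum_(i <- s) \int[mu]_(x in D) f i x * c i.
Proof.
move=> mD fi; rewrite Rintegral_sum// => [|i _].
  by apply: eq_bigr => i _; rewrite RintegralZr.
apply: (eq_integrable mD _ _ _ (integrableZr mD (c i) (fi i))) => x _.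
by rewrite /= EFinM.
Qed.

Lemma integral_okD D (f g : X -> R) : integral_ok mu D f -> integral_ok mu D g ->
  integral_ok mu D (fun x => f x + g x).
Proof.
move=> [mD fi] [_ gi]; split => //.
apply: (eq_integrable mD _ _ _ (integrableD mD fi gi)) => x _.
by rewrite /= EFinD.
Qed.

Lemma integral_okB D (f g : X -> R) : integral_ok mu D f -> integral_ok mu D g ->
  integral_ok mu D (fun x => f x - g x).
Proof.
move=> [mD fi] [_ gi]; split => //.
apply: (eq_integrable mD _ _ _ (integrableB mD fi gi)) => x _.
by rewrite /= EFinB.
Qed.

Lemma integral_ok_cst D (c : R) : measurable D -> (mu D < +oo)%E ->
  integral_ok mu D (fun=> c).
Proof.
move=> mD Doo; split => //; apply: measurable_bounded_integrable => //.
by exists `|c|; split=> [|r cr x _ /=]; [exact: num_real|exact: ltW].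
Qed.

Lemma RintegralD_ok D (f g : X -> R) : integral_ok mu D f -> integral_ok mu D g ->
  \int[mu]_(x in D) (f x + g x)
  = \int[mu]_(x in D) f x + \int[mu]_(x in D) g x.
Proof. by move=> [mD fi] [_ gi]; rewrite RintegralD. Qed.

Lemma RintegralB_ok D (f g : X -> R) : integral_ok mu D f -> integral_ok mu D g ->
  \int[mu]_(x in D) (f x - g x)
  = \int[mu]_(x in D) f x - \int[mu]_(x in D) g x.
Proof. by move=> [mD fi] [_ gi]; rewrite RintegralB. Qed.

Lemma RintegralN_ok D (f : X -> R) : integral_ok mu D f ->
  \int[mu]_(x in D) - f x = - \int[mu]_(x in D) f x.
Proof.
move=> [mD fi]; under eq_Rintegral do rewrite -mulN1r.
by rewrite RintegralZl// mulN1r.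
Qed.

(** After extension by zero to the whole space, the sum of the pieces and [f] agree almost
    everywhere: almost every point of [D] lies in exactly one piece, and the pieces almost stay
    inside [D]. *)
Lemma Rintegral_pieces D (f : X -> R) (I : finType) (Q : pred I)
    (P : I -> set X) (h : I -> X -> R) :
  integral_ok mu D f ->
  (forall i, Q i -> integral_ok mu (P i) (h i)) ->
  {ae mu, forall x,
    (D x -> exists i, [/\ Q i, P i x, (forall j, Q j -> P j x -> j = i)
                        & f x = h i x]) /\
    (forall i, Q i -> P i x -> D x)} ->
  \int[mu]_(x in D) f x = \sum_(i | Q i) \int[mu]_(x in P i) h i x.
Proof.
move=> [mD fi] hP ae.
have hi i : Q i -> mu.-integrable setT (EFin \o (h i \_ (P i))).
  move=> /hP[mP hi]; rewrite -restrict_EFin.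
  exact: (iffLR (integrable_mkcond _ mP) hi).
have fT : mu.-integrable setT (EFin \o (f \_ D)).
  rewrite -restrict_EFin; exact: (iffLR (integrable_mkcond _ mD) fi).
rewrite Rintegral_mkcond.
under eq_bigr do rewrite Rintegral_mkcond.
rewrite -Rintegral_sum//; congr fine; apply: ae_eq_integral => //.
- exact: measurable_int fT.
- have := integrable_sum measurableT (index_enum I) hi.
  move=> /(measurable_int mu); apply: eq_measurable_fun => x _.
  by rewrite /= sumEFin.
apply: filterS ae => x [Dx PD] _ /=; congr EFin.
rewrite patchE; case: ifPn => [/set_mem/Dx[i [Qi Pi uni ->]]|].
  rewrite (bigD1 i)//= patchE mem_set// big1 ?addr0// => j /andP[Qj ji].
  rewrite patchE ifF//; apply: contraNF ji => /set_mem Pj.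
  by apply/eqP; exact: uni.
move=> nD; rewrite big1// => i Qi; rewrite patchE ifF//.
by apply: contraNF nD => /set_mem /(PD _ Qi) Dx'; exact/mem_set.
Qed.

Import HBNNSimple.

(** The integral of a nonnegative function is a supremum over simple functions below it. Setting
    such a simple function to zero on the null set [N] keeps its integral and moves it below [g],
    whether or not [f] and [g] are measurable. *)
Lemma le_ae_nnintegral (N : set X) (f g : X -> \bar R) :
    measurable N -> mu N = 0%E ->
    (forall x, 0 <= f x)%E -> (forall x, 0 <= g x)%E ->
    (forall x, ~ N x -> f x <= g x)%E ->
  (\int[mu]_x f x <= \int[mu]_x g x)%E.
Proof.
move=> mN N0 f0 g0 fg; rewrite ge0_integralTE//.
apply: ge_ereal_sup => _ [h hf <-].
have mTN : measurable ([set: X] `\` N) by exact: measurableD.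
have -> : sintegral mu h = sintegral mu (proj_nnsfun h mTN).
  rewrite -mrestrict -integral_nnsfun//.
  transitivity (\int[mu]_x (h x)%:E)%E.
    by rewrite integral_nnsfun// patch_setT.
  rewrite (ge0_negligible_integral mN)//.
  - by apply/measurable_realfun.measurable_EFinP.
  - by move=> x _; rewrite lee_fin.
rewrite ge0_integralTE//; apply: ereal_sup_ubound.
exists (proj_nnsfun h mTN) => // x; rewrite -mrestrict patchE.
case: ifPn => [/set_mem[_ nNx]|_]; last exact: g0.
by rewrite (le_trans (hf x))// fg.
Qed.

(* No measurability is assumed: the product measures are not complete, and
   integrands agreeing almost everywhere need not be measurable together. *)
Lemma ae_Rintegral D (f g : X -> R) : {ae mu, forall x, D x -> f x = g x} ->
  \int[mu]_(x in D) f x = \int[mu]_(x in D) g x.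
Proof.
move=> [N [mN N0 fgN]]; rewrite Rintegral_mkcond [RHS]Rintegral_mkcond.
have fg x : ~ N x -> (f \_ D) x = (g \_ D) x.
  move=> nNx; rewrite !patchE; case: ifPn => // /set_mem Dx.
  by apply: contrapT => fgx; apply/nNx/fgN => /= /(_ Dx).
congr fine; rewrite integralE [RHS]integralE.
by congr (_ - _)%E; apply/eqP; rewrite eq_le; apply/andP; split;
  apply: (le_ae_nnintegral mN N0) => // x /fg;
  rewrite ?funeposE ?funenegE /= => ->.
Qed.

Lemma Rintegral_ae0 D (f : X -> R) : {ae mu, forall x, D x -> f x = 0} ->
  \int[mu]_(x in D) f x = 0.
Proof.
move=> /ae_Rintegral ->.
by rewrite Rintegral_mkcond (_ : _ \_ _ = fun=> 0) ?Rintegral_cst ?mul0r//;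
  apply/funext => x; rewrite patchE; case: ifP.
Qed.

(** Integrability is known for [f] and for the parts [a], while [b] will be the oscillation of the
    data. On each piece [b] equals [f - a] almost everywhere, which determines its integral. *)
Lemma Rintegral_pieces_split D (f : X -> R) (I : finType) (Q : pred I)
    (P : I -> set X) (a b : I -> X -> R) :
  integral_ok mu D f ->
  (forall i, Q i -> integral_ok mu (P i) (a i)) ->
  {ae mu, forall x,
    (D x -> exists i, [/\ Q i, P i x, (forall j, Q j -> P j x -> j = i)
                        & f x = a i x + b i x]) /\
    (forall i, Q i -> P i x -> D x)} ->
  \int[mu]_(x in D) f x
  = \sum_(i | Q i) \int[mu]_(x in P i) a i x
    + \sum_(i | Q i) \int[mu]_(x in P i) b i x.
Proof.
move=> [mD fi] ok ae.
have fT : mu.-integrable setT (EFin \o (f \_ D)).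
  rewrite -restrict_EFin; exact: (iffLR (integrable_mkcond _ mD) fi).
have fP i : Q i -> integral_ok mu (P i) (f \_ D).
  by move=> /ok[mP _]; split => //; exact: integrableS fT.
rewrite (@Rintegral_pieces D f I Q P (fun=> f \_ D))//; last first.
  apply: filterS ae => x [Dx PD]; split=> // /[dup] Dx' /Dx[i [Qi Pi uni _]].
  by exists i; split => //; rewrite patchE mem_set.
rewrite -big_split /=; apply: eq_bigr => i Qi.
rewrite -[LHS](subrK (\int[mu]_(x in P i) a i x)) addrC.
congr (_ + _); rewrite -RintegralB_ok//; [|exact: fP|exact: ok].
apply: ae_Rintegral; apply: filterS ae => x [Dx PD] Pi.
have Dx' := PD _ Qi Pi; have [j [Qj _ uni fE]] := Dx Dx'.
by rewrite patchE mem_set// fE (uni _ Qi Pi) addrAC subrr add0r.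
Qed.

End Integration.

(** * Null sets of product measures and of outer measures *)

Section ProductNull.
Context {d1 d2} {X1 : measurableType d1} {X2 : measurableType d2} {R : realType}.
Variables (m1 : {measure set X1 -> \bar R})
  (m2 : {sigma_finite_measure set X2 -> \bar R}).

Lemma ae_prod_fst (Q : X1 -> Prop) : {ae m1, forall x, Q x} ->
  {ae (m1 \x m2)%E, forall p, Q p.1}.
Proof.
move=> [N [mN N0 subN]]; exists (N `*` setT); split.
- exact: measurableX.
- by rewrite /= product_measure1E// N0 mul0e.
- by move=> p /= nQ; split => //; exact: subN.
Qed.

Lemma ae_prod_snd (Q : X2 -> Prop) : {ae m2, forall x, Q x} ->
  {ae (m1 \x m2)%E, forall p, Q p.2}.
Proof.
move=> [N [mN N0 subN]]; exists (setT `*` N); split.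
- exact: measurableX.
- by rewrite /= product_measure1E// N0 mule0.
- by move=> p /= nQ; split => //; exact: subN.
Qed.

End ProductNull.

(** A set of outer measure zero splits every set additively, by monotonicity, hence is Caratheodory
    measurable. This makes the overlap conditions of the mesh usable as statements almost
    everywhere. *)
Lemma outer_null_ae {T : pointedType} {R : realType}
    (om : {outer_measure set T -> \bar R}) (A : set T) : om A = 0%E ->
  {ae (om : {measure set (caratheodory_type om) -> \bar R}), forall x, ~ A x}.
Proof.
move=> A0; exists A; split => //; last by move=> x /= /contrapT.
apply: le_caratheodory_measurable => Y.
have -> : om (Y `&` A) = 0%E.
  by apply/eqP; rewrite -measure_le0 -A0 le_outer_measure//; exact: subIsetr.
by rewrite add0e le_outer_measure//; exact: subIsetl.
Qed.

(** * Smoothness of the Euler flux and the mean value identity *)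

Section FluxCalculus.
Context {R : realType} {d : nat}.
Local Notation S := (state R d).
Implicit Types (f g : S -> R) (u v w : S) (k : 'I_d).

(* Continuously differentiable on the states of positive density, with an
   explicit derivative so that no neighbourhood has to be restricted. *)
Definition c1_dpos f := exists df : S -> S -> R, forall u, 0 < density u ->
  differentiable f u /\
  forall w, 'D_w f u = df u w /\ {for u, continuous (df ^~ w)}.

Lemma c1_dpos_cst (c : R) : c1_dpos (fun=> c).
Proof.
exists (fun _ _ => 0) => u _; split=> [|w]; first exact: differentiable_cst.
by split; [exact: derive_cst|exact: cst_continuous].
Qed.

Lemma c1_dpos_coord i j : c1_dpos (fun u => u i j).
Proof.
exists (fun _ w => w i j) => u _; split=> [|w]; first exact: differentiable_coord.
split; last exact: cst_continuous.
have := @derive_id R S u w; rewrite derive_mx; last exact: derivable_id.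
by move=> /matrixP /(_ i j); rewrite mxE.
Qed.

Lemma c1_dposD f g : c1_dpos f -> c1_dpos g -> c1_dpos (fun u => f u + g u).
Proof.
move=> [df fE] [dg gE]; exists (fun u w => df u w + dg u w) => u u0.
have [[fu df_u] [gu dg_u]] := (fE u u0, gE u u0).
split=> [|w]; first exact: differentiableD.
have [[<- cf] [<- cg]] := (df_u w, dg_u w).
by split; [rewrite deriveD//; exact: diff_derivable|exact: continuousD].
Qed.

Lemma c1_dposM f g : c1_dpos f -> c1_dpos g -> c1_dpos (fun u => f u * g u).
Proof.
move=> [df fE] [dg gE].
exists (fun u w => f u * dg u w + g u * df u w) => u u0.
have [[fu df_u] [gu dg_u]] := (fE u u0, gE u u0).
split=> [|w]; first exact: differentiableM.
have [[<- cf] [<- cg]] := (df_u w, dg_u w).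
split; first by rewrite deriveM//; exact: diff_derivable.
by apply: continuousD; apply: continuousM => //; exact: differentiable_continuous.
Qed.

Lemma c1_dposV f : (forall u, 0 < density u -> f u != 0) ->
  c1_dpos f -> c1_dpos (fun u => (f u)^-1).
Proof.
move=> f0 [df fE]; exists (fun u w => - (f u) ^- 2 * df u w) => u u0.
have [fu df_u] := fE u u0; have fn0 := f0 u u0.
split=> [|w]; first exact: differentiableV.
have [<- cf] := df_u w.
split; first by rewrite deriveV//; exact: diff_derivable.
have fc := differentiable_continuous fu.
apply: continuousM => //; apply: continuousN; apply: continuousV.
  by rewrite expf_neq0.
exact: (continuousM fc fc).
Qed.

Lemma c1_dpos_sum (I : Type) (s : seq I) (F : I -> S -> R) :
  (forall i, c1_dpos (F i)) -> c1_dpos (fun u => \sum_(i <- s) F i u).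
Proof.
move=> F1; elim: s => [|i s IH].
  by under eq_fun do rewrite big_nil; exact: c1_dpos_cst.
by under eq_fun do rewrite big_cons; exact: c1_dposD.
Qed.

Lemma density_coord u : density u = u (lshift (d + 1) 0) 0.
Proof. by rewrite /density mxE. Qed.

(** Each component is a rational function of the conserved variables whose denominators are powers
    of the density, so the closure properties of [c1_dpos] suffice, block by block. *)
Lemma c1_dpos_flux k i : c1_dpos (fun u => flux k u i 0).
Proof.
have c1d : c1_dpos (@density R d).
  rewrite (_ : @density R d = fun u => u (lshift (d + 1) 0) 0).
    exact: c1_dpos_coord.
  by apply/funext => u; rewrite density_coord.
have c1i : c1_dpos (fun u => (density u)^-1).
  by apply: c1_dposV => // u /lt0r_neq0.
have c1v l : c1_dpos (fun u => velocity u l).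
  apply: c1_dposM => //; under eq_fun do rewrite !mxE; exact: c1_dpos_coord.
have c1e : c1_dpos (@energy R d).
  apply: c1_dposM => //; under eq_fun do rewrite !mxE; exact: c1_dpos_coord.
have c1p : c1_dpos (@pressure R d).
  apply: c1_dposM; last exact: c1_dpos_cst.
  apply: c1_dposM => //; apply: c1_dposD => //.
  under eq_fun do rewrite -mulNr.
  apply: c1_dposM; first exact: c1_dpos_cst.
  by apply: c1_dpos_sum => l; under eq_fun do rewrite expr2; exact: c1_dposM.
case: (split_ordP i) => [j ->|{}i ->].
  have -> : (fun u => flux k u (lshift (d + 1) j) 0)
      = fun u => density u * velocity u k.
    by apply/funext => u; rewrite /flux col_mxEu mxE ord1 eqxx mulr1n.
  exact: c1_dposM.
case: (split_ordP i) => [j ->|j ->].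
  have -> : (fun u => flux k u (rshift 1 (lshift 1 j)) 0)
      = fun u => density u * velocity u j * velocity u k
                 + (j == k)%:R * pressure u.
    by apply/funext => u; rewrite /flux col_mxEd col_mxEu mxE.
  apply: c1_dposD; first by apply: c1_dposM => //; exact: c1_dposM.
  by apply: c1_dposM => //; exact: c1_dpos_cst.
have -> : (fun u => flux k u (rshift 1 (rshift d j)) 0)
    = fun u => velocity u k * (density u * energy u + pressure u).
  by apply/funext => u; rewrite /flux !col_mxEd mxE ord1 eqxx mulr1n.
by apply: c1_dposM => //; apply: c1_dposD => //; exact: c1_dposM.
Qed.

Lemma density_line u v (t : R) : 0 < density u -> 0 < density v ->
  0 <= t <= 1 -> 0 < density (v + t *: (u - v)).
Proof.
move=> u0 v0 /andP[t0 t1].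
have -> : density (v + t *: (u - v)) = (1 - t) * density v + t * density u.
  by rewrite !density_coord !mxE mulrBr mulrBl mul1r addrAC addrA.
move: t0; rewrite le_eqVlt => /predU1P[<-|t0].
  by rewrite subr0 mul1r mul0r addr0.
by rewrite ltr_wpDl ?mulr_gt0// mulr_ge0 ?subr_ge0// ltW.
Qed.

(** The difference quotients coincide as functions of [h], so derivability and the derivative along
    a line both transfer by rewriting, without a chain rule. *)
Lemma line_growth f v w (t : R) :
  (fun h : R => h^-1 *: (((fun s : R => f (v + s *: w)) \o shift t) (h *: 1)
                         - f (v + t *: w)))
  = (fun h => h^-1 *: ((f \o shift (v + t *: w)) (h *: w) - f (v + t *: w))).
Proof.
by apply/funext => h /=; rewrite -[h *: 1]/(h * 1) mulr1 scalerDl addrCA.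
Qed.

Lemma derive_line f v w (t : R) :
  derive (fun s : R => f (v + s *: w)) t 1 = 'D_w f (v + t *: w).
Proof. by rewrite /derive line_growth. Qed.

Lemma derivable_line f v w (t : R) : derivable f (v + t *: w) w ->
  derivable (fun s : R => f (v + s *: w)) t 1.
Proof. by rewrite /derivable line_growth. Qed.

Lemma continuous_line v w : continuous (fun t : R => v + t *: w).
Proof.
move=> t; apply: differentiable_continuous.
by apply: differentiableD => //; apply: differentiableZl.
Qed.

Lemma within_line (f : S -> R) u v :
  (forall x, 0 < density x -> {for x, continuous f}) ->
  0 < density u -> 0 < density v ->
  {within `[0, 1], continuous (fun t : R => f (v + t *: (u - v)))}.
Proof.
move=> fc u0 v0; apply: continuous_in_subspaceT => t.
rewrite inE/= in_itv/= => t01.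
apply: (@continuous_comp _ _ _ (fun t : R => v + t *: (u - v)) f).
  exact: continuous_line.
by apply: fc; exact: density_line.
Qed.

(** The fundamental theorem of calculus for [G], the restriction of [f] to the line through [v] in
    direction [u - v]. Convexity of positive density keeps the whole closed segment in the region
    where [df] is continuous. *)
Lemma c1_dpos_FTC f u v : c1_dpos f -> 0 < density u -> 0 < density v ->
  \int[lebesgue_measure]_(t in `[0, 1]) 'D_(u - v) f (v + t *: (u - v))
  = f u - f v.
Proof.
move=> [df fE] u0 v0; set w := u - v.
pose G (s : R) := f (v + s *: w).
have dpos t : 0 <= t <= 1 -> 0 < density (v + t *: w) by exact: density_line.
have dG t : 0 <= t <= 1 -> derivable G t 1.
  move=> /dpos/fE[fd _]; apply: derivable_line; exact: diff_derivable.
have cG t : 0 <= t <= 1 -> {for t, continuous G}.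
  by move=> /dG /derivable1_diffP; exact: differentiable_continuous.
transitivity (\int[lebesgue_measure]_(t in `[0, 1]) df (v + t *: w) w).
  apply: eq_Rintegral => t; rewrite inE/= in_itv/= => /dpos/fE[_ /(_ w)[-> _]] //.
rewrite /Rintegral (@continuous_FTC2 _ (fun t => df (v + t *: w) w) G)//=.
- by rewrite /G scale1r scale0r addr0 /w [v + _]addrC subrK.
- apply: (@within_line (df^~ w)) => // x x0.
  by have [_ /(_ w)[]] := fE x x0.
- split=> [t||].
  + by rewrite in_itv/= => /andP[/ltW t0 /ltW t1]; apply: dG; rewrite t0.
  + by apply: cvg_at_right_filter; apply: cG; rewrite lexx ler01.
  + by apply: cvg_at_left_filter; apply: cG; rewrite lexx ler01.
- move=> t; rewrite in_itv/= => /andP[/ltW t0 /ltW t1].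
  have t01 : 0 <= t <= 1 by rewrite t0.
  by rewrite derive1E derive_line; have [_ /(_ w)[-> _]] := fE _ (dpos _ t01).
Qed.

Lemma derive_delta f u w : differentiable f u ->
  'D_w f u = \sum_i 'D_(delta_mx i 0) f u * w i 0.
Proof.
move=> fu; rewrite deriveE// [in LHS](matrix_sum_delta w) linear_sum.
apply: eq_bigr => i _; rewrite big_ord1 linearZ/= deriveE//.
by rewrite mulrC.
Qed.

Lemma jac_flux k u i j : 0 < density u ->
  jac (flux k) u i j = 'D_(delta_mx j 0) (fun x => flux k x i 0) u.
Proof.
move=> u0; rewrite mxE derive_mx ?mxE//; apply/derivable_mxP => l m.
rewrite ord1; have [df /(_ u u0)[fu _]] := c1_dpos_flux k l.
exact: diff_derivable.
Qed.

(** The Jacobian applied to [u - v] is the derivative of the flux in the direction [u - v], whose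
    integral along the segment is the flux difference. *)
Lemma avg_jac_mul k u v : 0 < density u -> 0 < density v ->
  avg_jac k u v *m (u - v) = flux k u - flux k v.
Proof.
move=> u0 v0; apply/matrixP => i j; rewrite ord1 {j} mxE.
transitivity (flux k u i 0 - flux k v i 0); last by rewrite !mxE.
rewrite -(c1_dpos_FTC (c1_dpos_flux k i) u0 v0).
have [df fE] := c1_dpos_flux k i.
have dpos t : t \in `[0, 1] -> 0 < density (v + t *: (u - v)).
  by rewrite in_itv/=; exact: density_line.
(* The Jacobian entries are traded for the continuous [df], which gives the integrability needed to
   exchange the sum over [l] with the integral. *)
have jacE l : {in `[0, 1]%classic, (fun t => jac (flux k) (v + t *: (u - v)) i l)
    =1 (fun t => df (v + t *: (u - v)) (delta_mx l 0))}.
  move=> t; rewrite inE/= => /dpos t0; rewrite jac_flux//.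
  by have [_ /(_ (delta_mx l 0))[]] := fE _ t0.
have mI : measurable (`[0%R, 1%R]%classic : set R) by exact: measurable_itv.
have dfi l : lebesgue_measure.-integrable `[0%R, 1%R]%classic
    (EFin \o fun t => df (v + t *: (u - v)) (delta_mx l 0)).
  apply: continuous_compact_integrable; first exact: segment_compact.
  apply: (@within_line (df^~ (delta_mx l 0))) => // x x0.
  by have [_ /(_ (delta_mx l 0))[]] := fE x x0.
have avgE l : avg_jac k u v i l
    = \int[lebesgue_measure]_(t in `[0, 1]) df (v + t *: (u - v)) (delta_mx l 0).
  by rewrite mxE; apply: eq_Rintegral => t tI; exact: jacE.
under eq_bigr do rewrite avgE.
rewrite -Rintegral_sumZr//.
apply: eq_Rintegral => t /set_mem/= /dpos t0.
have [fd fw] := fE _ t0; rewrite derive_delta//.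
by apply: eq_bigr => l _; have [-> _] := fw (delta_mx l 0).
Qed.

End FluxCalculus.

(** * Top and bottom of the cylinder: pure outflow and pure inflow *)

Section TimeNormals.
Context {R : realType} {d : nat}.
Implicit Type u : state R d.

(** Conjugation fixes a scalar matrix, so every diagonalization has the constant eigenvalue [c] and
    the candidate in [xget] is unique. The normal Jacobian is of this kind for normals in the time
    direction. *)
Lemma spectral_map_scalar n (chi : R -> R) (c : R) :
  spectral_map chi (c%:M : 'M[R]_n) = (chi c)%:M.
Proof.
rewrite /spectral_map; case: xgetP => [_ -> [Q [l [Qu cE ->]]]|/(_ (chi c)%:M)].
  have lE : diag_mx l = c%:M.
    have : invmx Q *m c%:M *m Q = diag_mx l.
      by rewrite cE !mulmxA mulVmx// mul1mx -mulmxA mulVmx// mulmx1.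
    by rewrite mul_mx_scalar -scalemxAl mulVmx// scalemx1.
  have -> : diag_mx (map_mx chi l) = (chi c)%:M.
    apply/matrixP => i j; rewrite !mxE; case: eqP => // _.
    by move/matrixP: lE => /(_ i i); rewrite !mxE eqxx !mulr1n => ->.
  by rewrite mul_mx_scalar -scalemxAl mulmxV// scalemx1.
case; exists 1%:M, (const_mx c); split; first exact: unitmx1.
  by rewrite invmx1 mulmx1 mul1mx diag_const_mx.
by rewrite invmx1 mulmx1 mul1mx map_const_mx diag_const_mx.
Qed.

Lemma stflux_time (c : R) u : stflux (0, c) u = c *: u.
Proof. by rewrite /stflux big1 ?add0r// => k _; rewrite mxE scale0r. Qed.

Lemma jac_stflux_time (c : R) u : jac (stflux (0, c)) u = c%:M.
Proof.
have -> : stflux (0, c) = (fun u => c *: u) :> (state R d -> state R d).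
  by apply/funext => v; exact: stflux_time.
apply/matrixP => i j; rewrite !mxE deriveZ; last exact: derivable_id.
by rewrite derive_id !mxE eqxx andbT mulr_natr.
Qed.

Lemma Pp_top u : Pp (0, 1) u = 1%:M.
Proof.
by rewrite /Pp jac_stflux_time /Pplus spectral_map_scalar sgr1 max_r ?ler01.
Qed.

Lemma Pm_top u : Pm (0, 1) u = 0.
Proof.
rewrite /Pm jac_stflux_time /Pminus spectral_map_scalar sgrN sgr1 max_l ?lerN10//.
by apply/matrixP => i j; rewrite !mxE mul0rn.
Qed.

Lemma Pp_bottom u : Pp (0, -1) u = 0.
Proof.
rewrite /Pp jac_stflux_time /Pplus spectral_map_scalar sgrN sgr1 max_l ?lerN10//.
by apply/matrixP => i j; rewrite !mxE mul0rn.
Qed.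

Lemma Pm_bottom u : Pm (0, -1) u = 1%:M.
Proof.
by rewrite /Pm jac_stflux_time /Pminus spectral_map_scalar opprK sgr1 max_r ?ler01.
Qed.

Lemma outflow_top u : outflow (0, 1) u = u.
Proof. by rewrite /outflow Pp_top mul1mx stflux_time scale1r. Qed.

Lemma outflow_bottom u : outflow (0, -1) u = 0.
Proof. by rewrite /outflow Pp_bottom mul0mx. Qed.

End TimeNormals.

#[local] Instance leb_ae_filter {R : realType} {d : nat} :
  Filter (nbhs (almost_everywhere (@leb R d))).
Proof. exact: (@ae_filter_ringOfSetsType _ _ _ (@leb R d)). Qed.

#[local] Instance surf_ae_filter {R : realType} {d : nat} :
  Filter (nbhs (almost_everywhere (@surf R d))).
Proof. exact: (@ae_filter_ringOfSetsType _ _ _ (@surf R d)). Qed.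

#[local] Instance stvol_ae_filter {R : realType} {d : nat} :
  Filter (nbhs (almost_everywhere (@stvol R d))).
Proof. exact: (@ae_filter_ringOfSetsType _ _ _ (@stvol R d)). Qed.

#[local] Instance stsurf_ae_filter {R : realType} {d : nat} :
  Filter (nbhs (almost_everywhere (@stsurf R d))).
Proof. exact: (@ae_filter_ringOfSetsType _ _ _ (@stsurf R d)). Qed.

(** * Cells, faces and time slabs cover the space-time sets uniquely almost everywhere *)

Section MeshGeometry.
Context {R : realType} {d : nat}.
Variables (Omega : set 'rV[R]_d) (T : R) (M : mesh R d).
Hypothesis HM : is_mesh Omega T M.
Local Notation S := (state R d).
Implicit Types (x : 'rV[R]_d) (t : R) (i j : cell M) (e : face M).

Lemma cell_closure_uniq i j x :
  cell_set i x -> closure (cell_set j) x -> j = i.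
Proof.
move=> ix jx; apply/eqP; apply: contraT => ji.
have /jx[y [jy iy]] : nbhs x (cell_set i).
  by apply: open_nbhs_nbhs; split => //; exact: (mesh_open HM).
by have := mesh_disj HM ji; rewrite -subset0 => /(_ y (conj jy iy)).
Qed.

(** Every point of [Omega] lies in the closure of some cell; if it misses that cell it is on its
    boundary, hence on one of finitely many faces of volume zero. *)
Lemma cell_ae : {ae @leb R d, forall x, Omega x -> exists i, cell_set i x}.
Proof.
have nfae : {ae @leb R d, forall x e, ~ face_set e x}.
  by apply: filter_forall => e; exact: (outer_null_ae (mesh_face_null HM e)).
apply: (filterS _ nfae) => x nface Ox.
have : closure Omega x by exact: subset_closure.
rewrite (mesh_cover HM) => -[i _ ix]; exists i.
apply: contrapT => nix.
have : bdry (cell_set i) x by split => // /interior_subset.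
by rewrite (mesh_bdry HM) => -[e _]; exact: nface.
Qed.

Lemma is_bdry_face_inc e i j : is_bdry_face e -> inc i e -> inc j e -> j = i.
Proof.
move=> /card1P[k ke] ie je.
have := ke i; have := ke j; rewrite !inE ie je.
by move=> /esym/eqP -> /esym/eqP ->.
Qed.

Lemma face_closure e i : inc i e -> face_set e `<=` closure (cell_set i).
Proof.
move=> ie x ex; have : bdry (cell_set i) x by rewrite (mesh_bdry HM); exists e.
by case.
Qed.

Lemma face_ae : {ae @surf R d, forall x e e',
  e != e' -> ~ (face_set e x /\ face_set e' x)}.
Proof.
apply: filter_forall => e; apply: filter_forall => e'.
have [->|ee'] := eqVneq e e'; first exact: filterE.
apply: (filterS _ (outer_null_ae (mesh_face_meet HM ee'))) => x xN _ xee'.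
exact: xN.
Qed.

(** Off the face overlaps a boundary point determines its face [e]. A second cell touching the point
    would, off the exceptional part of [mesh_meet], share a face through it; that face is [e], and a
    boundary face belongs to one cell only. *)
Lemma bdry_face_ae : {ae @surf R d, forall x,
  (bdry Omega x -> exists i e,
    [/\ is_bdry_face e, inc i e, face_set e x &
       (forall e', face_set e' x -> e' = e) /\
       (forall j, closure (cell_set j) x -> j = i)]) /\
  (forall e, is_bdry_face e -> face_set e x -> bdry Omega x)}.
Proof.
have meet : {ae @surf R d, forall x i j, i != j ->
    ~ ((closure (cell_set i) `&` closure (cell_set j))
       `\` \bigcup_(e in [set e | inc i e && inc j e]) face_set e) x}.
  apply: filter_forall => i; apply: filter_forall => j.
  have [->|ij] := eqVneq i j; first exact: filterE.
  by apply: (filterS _ (outer_null_ae (mesh_meet HM ij))) => x xN _; exact: xN.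
apply: (filterS _ (filterI meet face_ae)) => x [xmeet xface].
split; last by move=> e be ex; rewrite (mesh_bdryT HM); exists e.
rewrite (mesh_bdryT HM) => -[e /= be ex].
have [i ie] : exists i, inc i e.
  by have /card1P[i ie] := be; exists i; have := ie i; rewrite !inE eqxx.
exists i, e; have euniq e' : face_set e' x -> e' = e.
  by move=> e'x; apply/eqP; apply: contraT => /xface; case.
split => //; split => // j jx; apply/eqP; apply: contraT => ji.
exfalso; apply: (xmeet _ _ ji); split.
  by split => //; exact: face_closure ie _ ex.
move=> [e' /andP[je' ie'] /euniq e'e]; move: je'; rewrite e'e => je.
by move/eqP: ji; apply; exact: is_bdry_face_inc be ie je.
Qed.

Lemma bdry_normalE i e x : is_bdry_face e -> inc i e -> face_set e x ->
  (forall e', face_set e' x -> e' = e) -> bdry_normal M x = nrm i e.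
Proof.
move=> be ie ex euniq; rewrite /bdry_normal; case: pickP => [[j e']|].
  move=> /and3P[/= be' je' /asboolP/euniq e'e]; move: je'; rewrite e'e => je.
  by rewrite (is_bdry_face_inc be ie je).
by move=> /(_ (i, e)); rewrite /= be ie asboolT.
Qed.

Lemma tm_lt m n : (m < n <= lvl M)%N -> tm M m < tm M n.
Proof.
elim: n => // n IH /andP[]; rewrite ltnS leq_eqVlt => /predU1P[-> nN|mn nN].
  exact: (mesh_tlt HM).
by apply: lt_trans (IH _) (mesh_tlt HM nN); rewrite mn ltnW.
Qed.

Lemma tm_le m n : (m <= n <= lvl M)%N -> tm M m <= tm M n.
Proof.
move=> /andP[]; rewrite leq_eqVlt => /predU1P[->//|mn nN].
by apply/ltW/tm_lt; rewrite mn.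
Qed.

Lemma slabE m t : slab M m.+1 t = (tm M m <= t <= tm M m.+1) :> Prop.
Proof. by rewrite /slab /= in_itv. Qed.

Lemma slab_sub (m : 'I_(lvl M)) t : slab M m.+1 t -> 0 <= t <= T.
Proof.
rewrite slabE => /andP[mt tm1]; rewrite -(mesh_t0 HM) -(mesh_tN HM).
rewrite (le_trans _ mt) ?(le_trans tm1)//; apply: tm_le; rewrite ?leqnn ?andbT//.
by rewrite leq0n ltnW.
Qed.

Lemma slab_exists t : 0 <= t <= T -> exists m : 'I_(lvl M), slab M m.+1 t.
Proof.
move=> /andP[t0 tT].
have ex : exists m, t <= tm M m by exists (lvl M); rewrite (mesh_tN HM).
(* The least level above [t] closes the slab containing [t]. No slab ends at level 0, so in that
   case the first slab is taken. *)
case: (ex_minnP ex) => -[|m] tm1 minm.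
  exists (Ordinal (mesh_lvl HM)); rewrite slabE /= (mesh_t0 HM) t0/=.
  apply: (le_trans tm1); apply: tm_le; exact: (mesh_lvl HM).
have mN : (m < lvl M)%N by apply: minm; rewrite (mesh_tN HM).
exists (Ordinal mN); rewrite slabE /= tm1 andbT.
by case: (leP (tm M m) t) => // /ltW /minm; rewrite ltnn.
Qed.

Lemma slab_uniq t (m n : 'I_(lvl M)) : (forall k : 'I_(lvl M).+1, t <> tm M k) ->
  slab M m.+1 t -> slab M n.+1 t -> n = m.
Proof.
move=> tN; rewrite !slabE => /andP[mt tm1] /andP[nt tn1].
apply/val_inj/eqP; rewrite /= eqn_leq; apply/andP; split; rewrite leqNgt.
  apply/negP => mn; apply: (tN (Ordinal (leqW (ltn_ord n : (n < lvl M)%N)))).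
  apply/eqP; rewrite eq_le nt andbT /=.
  by apply: (le_trans tm1); apply: tm_le; rewrite mn ltnW.
apply/negP => nm; apply: (tN (Ordinal (leqW (ltn_ord m : (m < lvl M)%N)))).
apply/eqP; rewrite eq_le mt andbT /=.
by apply: (le_trans tn1); apply: tm_le; rewrite nm ltnW.
Qed.

Lemma slab_top (m : 'I_(lvl M)) : slab M m.+1 T -> m.+1 = lvl M.
Proof.
rewrite slabE => /andP[_ Tm]; apply/eqP; rewrite eqn_leq ltn_ord leqNgt.
apply/negP => mN; move: Tm; rewrite leNgt -(mesh_tN HM) => /negP; apply.
by apply: tm_lt; rewrite mN leqnn.
Qed.

Lemma slab_bottom (m : 'I_(lvl M)) : slab M m.+1 0 -> m = 0%N :> nat.
Proof.
rewrite slabE => /andP[m0 _]; apply/eqP; rewrite -leqn0 leqNgt.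
apply/negP => m_gt0; move: m0; rewrite leNgt -[X in X < _](mesh_t0 HM).
by move=> /negP; apply; apply: tm_lt; rewrite m_gt0 ltnW.
Qed.

Lemma time_ae : {ae @lebesgue_measure R, forall t,
  forall k : 'I_(lvl M).+1, t <> tm M k}.
Proof.
apply: filter_forall => k; exists [set tm M k]; split => //.
- exact: lebesgue_measure_set1.
- by move=> t /contrapT.
Qed.

Lemma gridfun_valE (W : gridfun M) i (m : 'I_(lvl M)) x t :
  closure (cell_set i) x -> slab M m.+1 t ->
  (forall j, closure (cell_set j) x -> j = i) ->
  (forall n : 'I_(lvl M), slab M n.+1 t -> n = m) ->
  gridfun_val W (x, t) = W i m.+1.
Proof.
move=> ix mt iuniq muniq; rewrite /gridfun_val; case: pickP => [[j n]|].
  by move=> /asboolP[/= /iuniq -> /muniq ->].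
by move=> /(_ (i, m)); rewrite asboolT.
Qed.

Lemma cyl_cells_ae : {ae @stvol R d, forall p,
  (cyl Omega T p -> exists im : cell M * 'I_(lvl M),
    [/\ cell_set im.1 p.1, slab M im.2.+1 p.2,
        forall jn : cell M * 'I_(lvl M),
          cell_set jn.1 p.1 -> slab M jn.2.+1 p.2 -> jn = im
      & forall W : gridfun M, gridfun_val W p = W im.1 im.2.+1]) /\
  (forall im : cell M * 'I_(lvl M),
    cell_set im.1 p.1 -> slab M im.2.+1 p.2 -> cyl Omega T p)}.
Proof.
apply: (filterS _ (filterI (ae_prod_fst _ cell_ae) (ae_prod_snd _ time_ae))).
move=> -[x t] /= [Ox tN]; split.
  move=> [/= /Ox[i ix]]; rewrite in_itv/= => /andP[t0 /ltW tT].
  have [m mt] : exists m : 'I_(lvl M), slab M m.+1 t.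
    by apply: slab_exists; rewrite t0.
  exists (i, m); split => //= [[j n] /= jx nt|W].
    have -> := cell_closure_uniq ix (subset_closure jx).
    by rewrite (slab_uniq tN mt nt).
  apply: gridfun_valE => //; first exact: subset_closure.
    by move=> j; exact: cell_closure_uniq.
  by move=> n; exact: slab_uniq.
move=> [i m] /= ix mt; split=> /=; first exact: (mesh_sub HM ix).
have /andP[t0 tT] := slab_sub mt.
(* The last slab contains [T] while the cylinder is half open; [T] is itself a time level and so is
   already excluded. *)
rewrite in_itv/= t0 lt_neqAle tT andbT; apply/eqP => tT'.
by apply: (tN ord_max); rewrite /= (mesh_tN HM).
Qed.

Lemma lateral_faces_ae : {ae @stsurf R d, forall p,
  (lateral Omega T p -> exists ime : cell M * 'I_(lvl M) * face M,
    [/\ is_bdry_face ime.2 && inc ime.1.1 ime.2,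
        (face_set ime.2 `*` slab M ime.1.2.+1) p,
        forall jne : cell M * 'I_(lvl M) * face M,
          is_bdry_face jne.2 && inc jne.1.1 jne.2 ->
          (face_set jne.2 `*` slab M jne.1.2.+1) p -> jne = ime
      & (forall W : gridfun M, gridfun_val W p = W ime.1.1 ime.1.2.+1) /\
        bdry_normal M p.1 = nrm ime.1.1 ime.2]) /\
  (forall ime : cell M * 'I_(lvl M) * face M,
     is_bdry_face ime.2 && inc ime.1.1 ime.2 ->
     (face_set ime.2 `*` slab M ime.1.2.+1) p -> lateral Omega T p)}.
Proof.
apply: (filterS _ (filterI (ae_prod_fst _ bdry_face_ae) (ae_prod_snd _ time_ae))).
move=> -[x t] /= [[bx xb] tN]; split.
  move=> [/= /bx[i [e [be ie ex [euniq iuniq]]]]].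
  rewrite in_itv/= => /slab_exists[m mt].
  exists (i, m, e); split => //=; first by rewrite be.
    move=> [[j n] e'] /= /andP[be' je'] [/= /euniq e'e nt].
    move: je'; rewrite e'e => je.
    by rewrite (is_bdry_face_inc be ie je) (slab_uniq tN mt nt).
  split; last exact: bdry_normalE.
  move=> W; apply: gridfun_valE => //; first exact: face_closure ie _ ex.
  by move=> n; exact: slab_uniq.
move=> [[i m] e] /= /andP[be ie] [/= ex mt]; split=> /=; first exact: xb ex.
by rewrite in_itv/=; exact: slab_sub mt.
Qed.

(** Only the last slab contains [T] and only the first contains 0. The trace at the bottom is
    therefore the value at level 1, not the initial average at level 0. *)
Lemma base_cells_ae : {ae @leb R d, forall x,
  (Omega x -> exists i,
    [/\ cell_set i x, forall j, cell_set j x -> j = i,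
        forall W : gridfun M, gridfun_val W (x, T) = W i (lvl M)
      & forall W : gridfun M, gridfun_val W (x, 0) = W i 1%N]) /\
  (forall i, cell_set i x -> Omega x)}.
Proof.
have T0 : 0 <= T.
  by rewrite -(mesh_t0 HM) -(mesh_tN HM); apply: tm_le; rewrite leqnn.
apply: (filterS _ cell_ae) => x Ox; split; last by move=> i; exact: (mesh_sub HM).
move=> /Ox[i ix]; exists i; split => // [j jx|W|W].
- exact: cell_closure_uniq ix (subset_closure jx).
- have [m mT] : exists m : 'I_(lvl M), slab M m.+1 T.
    by apply: slab_exists; rewrite lexx T0.
  rewrite -(slab_top mT); apply: gridfun_valE => //.
  + exact: subset_closure.
  + by move=> j; exact: cell_closure_uniq.
  + move=> n nT; apply/val_inj; apply/eqP; rewrite /= -eqSS.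
    by rewrite (slab_top mT) (slab_top nT).
- have [m m0] : exists m : 'I_(lvl M), slab M m.+1 0.
    by apply: slab_exists; rewrite lexx T0.
  rewrite -[in RHS](slab_bottom m0); apply: gridfun_valE => //.
  + exact: subset_closure.
  + by move=> j; exact: cell_closure_uniq.
  + move=> n n0; apply/val_inj; rewrite /=.
    by rewrite (slab_bottom m0) (slab_bottom n0).
Qed.

End MeshGeometry.

(** * The inner product of states *)

Section Dots.
Context {R : realType} {d : nat}.
Local Notation S := (state R d).
Implicit Types u v w : S.

Lemma dotsC u v : dots u v = dots v u.
Proof. by apply: eq_bigr => i _; rewrite mulrC. Qed.

Lemma dotsDl u v w : dots (u + v) w = dots u w + dots v w.
Proof. by rewrite -big_split; apply: eq_bigr => i _; rewrite mxE mulrDl. Qed.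

Lemma dotsNl u w : dots (- u) w = - dots u w.
Proof. by rewrite -sumrN; apply: eq_bigr => i _; rewrite mxE mulNr. Qed.

Lemma dotsBl u v w : dots (u - v) w = dots u w - dots v w.
Proof. by rewrite dotsDl dotsNl. Qed.

Lemma dotsZl (c : R) u w : dots (c *: u) w = c * dots u w.
Proof. by rewrite mulr_sumr; apply: eq_bigr => i _; rewrite mxE mulrA. Qed.

Lemma dots0l w : dots 0 w = 0.
Proof. by rewrite -(scale0r 0) dotsZl mul0r. Qed.

Lemma dotsDr u v w : dots u (v + w) = dots u v + dots u w.
Proof. by rewrite !(dotsC u) dotsDl. Qed.

Lemma dotsBr u v w : dots u (v - w) = dots u v - dots u w.
Proof. by rewrite !(dotsC u) dotsBl. Qed.

Lemma dots0r u : dots u 0 = 0.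
Proof. by rewrite dotsC dots0l. Qed.

Lemma dots_suml (I : Type) (s : seq I) (P : pred I) (F : I -> S) w :
  dots (\sum_(i <- s | P i) F i) w = \sum_(i <- s | P i) dots (F i) w.
Proof.
by elim/big_rec2: _ => [|i y x _ <-]; rewrite ?dots0l// dotsDl.
Qed.

Lemma dots_sumr (I : Type) (s : seq I) (P : pred I) (F : I -> S) w :
  dots w (\sum_(i <- s | P i) F i) = \sum_(i <- s | P i) dots w (F i).
Proof. by rewrite dotsC dots_suml; apply: eq_bigr => i _; exact: dotsC. Qed.

Lemma dots_trmx (A : 'M[R]_(1 + (d + 1))) u w :
  dots u (A^T *m w) = dots (A *m u) w.
Proof.
rewrite /dots; under eq_bigr do rewrite mxE mulr_sumr.
rewrite exchange_big; apply: eq_bigr => j _ /=.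
by rewrite mxE mulr_suml; apply: eq_bigr => i _; rewrite mxE mulrCA mulrA.
Qed.

Lemma dots_delta u i : dots u (delta_mx i 0) = u i 0.
Proof.
rewrite /dots (bigD1 i)//= big1 ?addr0 => [|j ji].
  by rewrite mxE !eqxx mulr1.
by rewrite mxE (negbTE ji) mulr0.
Qed.

End Dots.

(** * The variational form cell by cell *)

Section CellForm.
Context {R : realType} {d : nat} (M : mesh R d).
Variables (F : numflux M) (theta : R) (g : 'rV[R]_d * R -> state R d).
Variable W : gridfun M.
Local Notation X := ('rV[R]_d * R)%type.
Local Notation S := (state R d).
Implicit Types (phi : broken M) (i : cell M) (e : face M) (m : nat).

(** Boundary and volume terms of one space-time cell are kept together, so that a test function
    supported on one cell isolates a single summand of [Nform]. *)
Definition cell_form phi i m : R :=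
  (\sum_(e | inc i e) \int[stsurf]_(p in face_set e `*` slab M m)
                        dots (face_flux F g W m i e) (phi i m p)
   + \int[leb]_(x in cell_set i)
       dots (time_flux theta W m i) (phi i m (x, tm M m))
   + \int[leb]_(x in cell_set i)
       dots (- time_flux theta W m.-1 i) (phi i m (x, tm M m.-1)))
  - (\int[stvol]_(p in cell_set i `*` slab M m)
       dots (W i m) ('D_dirt (phi i m) p)
     + \int[stvol]_(p in cell_set i `*` slab M m) flux_grad (W i m) (phi i m) p).

Lemma NformE phi :
  Nform F theta g W phi = \sum_i \sum_(m < lvl M) cell_form phi i m.+1.
Proof.
rewrite /Nform -sumrB; apply: eq_bigr => i _; rewrite -sumrB.
by rewrite big_add1 big_mkord.
Qed.

(** The constant cancels in the difference quotient, so the equality also covers points where [f]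
    has no derivative; test functions have derivatives only almost everywhere. *)
Lemma derive_subc (f : X -> S) (c : S) v p :
  'D_v (fun q => f q - c) p = 'D_v f p.
Proof.
rewrite /derive (_ : (fun h => _) =
  (fun h => h^-1 *: ((f \o shift p) (h *: v) - f p)))//.
by apply/funext => h /=; rewrite opprB addrA subrK.
Qed.

Hypothesis finite_area : forall e : face M, (surf (face_set e) < +oo)%E.

Lemma stsurf_prism e m :
  measurable (face_set e : set (caratheodory_type (@hausdorff_om R d))) ->
  tm M m.-1 <= tm M m ->
  @stsurf R d (face_set e `*` slab M m) = (area e * dt M m)%:E.
Proof.
move=> mE tmm; have mS : measurable (slab M m : set (measurableTypeR R)).
  exact: measurable_itv.
have -> : @stsurf R d (face_set e `*` slab M m)
    = (surf (face_set e) * @lebesgue_measure R (slab M m))%E.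
  exact: (product_measure1E _ _ mE mS).
rewrite lebesgue_measure_itv /= lte_fin EFinM /area fineK; last first.
  by rewrite ge0_fin_numE.
congr (_ * _)%E; case: ifPn => // ; rewrite -leNgt => tle.
by rewrite /dt (_ : tm M m = tm M m.-1) ?subrr//; apply/eqP; rewrite eq_le tle.
Qed.

Lemma cell_form_cst (c : gridfun M) i m : tm M m.-1 <= tm M m ->
  (forall e, inc i e -> measurable (face_set e
                                : set (caratheodory_type (@hausdorff_om R d)))) ->
  measurable (cell_set i : set (caratheodory_type (@lebesgue_om R d))) ->
  cell_form (cst_broken c) i m
  = dots (dt M m *: (\sum_(e | inc i e) area e *: face_flux F g W m i e)
          + vol i *: (time_flux theta W m i - time_flux theta W m.-1 i)) (c i m).
Proof.
move=> tmm mE mC; rewrite /cell_form /cst_broken.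
rewrite [X in _ - (X + _)](_ : _ = 0); last first.
  by apply: Rintegral_ae0; apply: filterE => p _; rewrite derive_cst dots0r.
rewrite [X in _ - (_ + X)](_ : _ = 0); last first.
  apply: Rintegral_ae0; apply: filterE => p _; rewrite /flux_grad.
  by rewrite big1// => k _; rewrite derive_cst dots0r.
rewrite addr0 subr0 !Rintegral_cst// !dotsDl !dotsZl dots_suml mulr_sumr.
rewrite -/(vol i) dotsBl dotsNl -addrA; congr (_ + _); last first.
  by rewrite mulrBr mulNr ![vol i * _]mulrC.
apply: eq_bigr => e ie; rewrite dotsZl Rintegral_cst.
  rewrite stsurf_prism//=; last exact: mE.
  by rewrite mulrC mulrA [dt M m * _]mulrC.
by apply: measurableX; [exact: mE|exact: measurable_itv].
Qed.

End CellForm.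

(** * Consequences of Galerkin orthogonality *)

Section Galerkin.
Context {R : realType} {d : nat}.
Variables (Omega : set 'rV[R]_d) (T : R) (M : mesh R d).
Hypothesis HM : is_mesh Omega T M.
Variables (F : numflux M) (theta : R) (g : 'rV[R]_d * R -> state R d).
Variables (W : gridfun M) (phi : broken M).
Hypothesis okphi : Nform_ok F theta g W phi.
Implicit Types (i : cell M) (e : face M) (m : nat).

Lemma tm_pred m : (0 < m <= lvl M)%N -> tm M m.-1 <= tm M m.
Proof. by case: m => // m /andP[_ mN]; apply/ltW/(mesh_tlt HM). Qed.

Lemma measurable_face i e : inc i e ->
  measurable (face_set e : set (caratheodory_type (@hausdorff_om R d))).
Proof.
move=> ie; have N0 : (0 < 1 <= lvl M)%N by exact: (mesh_lvl HM).
have [/(_ e ie) [mS _] _ _ _ _] := okphi i N0.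
(* The hypothesis provides measurability of the prism over the face only; the face is its section at
   the initial time, which lies in the first slab. *)
have t0 : tm M 0 \in slab M 1.
  by rewrite inE slabE lexx; exact: (tm_pred N0).
by have := measurable_ysection (tm M 0) mS; rewrite in_ysectionX.
Qed.

Lemma measurable_cell i :
  measurable (cell_set i : set (caratheodory_type (@lebesgue_om R d))).
Proof.
have N0 : (0 < 1 <= lvl M)%N by exact: (mesh_lvl HM).
by have [_ [mC _] _ _ _] := okphi i N0.
Qed.

Let finite_vol i : (leb (cell_set i) < +oo)%E.
Proof. by have /andP[] := mesh_vol HM i. Qed.

Lemma cell_form_cst_ok (c : gridfun M) i m : (0 < m <= lvl M)%N ->
  cell_form F theta g W (cst_broken c) i m
  = dots (dt M m *: (\sum_(e | inc i e) area e *: face_flux F g W m i e)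
          + vol i *: (time_flux theta W m i - time_flux theta W m.-1 i)) (c i m).
Proof.
move=> mN; apply: cell_form_cst => //; first exact: (mesh_face_fin HM).
- exact: tm_pred.
- exact: measurable_face.
- exact: measurable_cell.
Qed.

(** Linearity is checked in each cell: constants are integrable because cells and faces have finite
    measure, and the volume terms do not see them. *)
Lemma Nform_cstB (c : gridfun M) :
  Nform F theta g W (fun i m p => phi i m p - cst_broken c i m p)
  = Nform F theta g W phi - Nform F theta g W (cst_broken c).
Proof.
rewrite !NformE -sumrB; apply: eq_bigr => i _; rewrite -sumrB.
apply: eq_bigr => -[m mN] _ /=.
have mN' : (0 < m.+1 <= lvl M)%N by [].
have [okf okt okb okv okx] := okphi i mN'.
have cst_leb (a : R) : integral_ok leb (cell_set i) (fun=> a).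
  by apply: integral_ok_cst; [exact: measurable_cell|exact: finite_vol].
have cst_surf (a : R) e : inc i e ->
    integral_ok stsurf (face_set e `*` slab M m.+1) (fun=> a).
  move=> ie; have [mS _] := okf e ie; apply: integral_ok_cst => //.
  rewrite (stsurf_prism (mesh_face_fin HM)) ?ltry//.
    exact: (measurable_face ie).
  exact: tm_pred.
rewrite /cell_form /cst_broken.
rewrite [X in _ = _ - (_ - (X + _))](_ : _ = 0); last first.
  by apply: Rintegral_ae0; apply: filterE => p _; rewrite derive_cst dots0r.
rewrite [X in _ = _ - (_ - (_ + X))](_ : _ = 0); last first.
  apply: Rintegral_ae0; apply: filterE => p _; rewrite /flux_grad.
  by rewrite big1// => k _; rewrite derive_cst dots0r.
rewrite addr0 subr0.
under [\int[stvol]_(p in _) dots _ _]eq_Rintegral do rewrite derive_subc.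
have gradc : flux_grad (W i m.+1) (fun p => phi i m.+1 p - c i m.+1)
    = flux_grad (W i m.+1) (phi i m.+1).
  by apply/funext => p; apply: eq_bigr => k _; rewrite derive_subc.
rewrite gradc [RHS]addrAC; congr (_ - _).
under eq_bigr => e ie.
  under eq_Rintegral do rewrite dotsBr.
  rewrite RintegralB_ok; [|exact: okf|exact: cst_surf].
  over.
under [\int[leb]_(x in _) dots (time_flux _ _ _ _) _]eq_Rintegral
  do rewrite dotsBr.
under [\int[leb]_(x in _) dots (- _) _]eq_Rintegral do rewrite dotsBr.
rewrite !RintegralB_ok// sumrB; ring.
Qed.

Lemma galerkin_balance i m : galerkin F theta g W -> (0 < m <= lvl M)%N ->
  dt M m *: (\sum_(e | inc i e) area e *: face_flux F g W m i e)
  + vol i *: (time_flux theta W m i - time_flux theta W m.-1 i) = 0.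
Proof.
case: m => // m gal /= mN; apply/matrixP => l j; rewrite ord1 {j} [RHS]mxE.
(* The test function is a unit vector on one space-time cell and zero elsewhere; it extracts
   component [l] of the balance in that cell. *)
pose c j n : state R d := if (j == i) && (n == m.+1) then delta_mx l 0 else 0.
have := gal c; rewrite NformE (bigD1 i)//= [X in _ + X]big1; last first.
  move=> j ji.
  rewrite big1// => -[n nN] _ /=; rewrite cell_form_cst_ok// /c (negbTE ji).
  by rewrite dots0r.
rewrite addr0 (bigD1 (Ordinal mN))//= [X in _ + X]big1; last first.
  move=> [n nN] nm.
  rewrite cell_form_cst_ok// /c eqxx /= ifF ?dots0r//.
  by apply: contraNF nm => /eqP[nm]; apply/eqP/val_inj.
by rewrite addr0 cell_form_cst_ok// /c !eqxx dots_delta.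
Qed.

(* Both the scheme and the Galerkin identity determine the increment of the
   time flux, so that the scheme is implicit whatever [theta] is. *)
Lemma time_fluxE i m : galerkin F theta g W -> fv_scheme F g W ->
  (m <= lvl M)%N -> time_flux theta W m i = W i m.
Proof.
move=> gal fv; elim: m => // m IH mN.
have bal := @galerkin_balance i m.+1 gal mN.
have vol0 : vol i != 0.
  have /andP[v0 _] := mesh_vol HM i.
  by rewrite /vol gt_eqF// fine_gt0// v0 finite_vol.
have := fv i m.+1 mN; rewrite [m.+1.-1]/= -(IH (ltnW mN)).
move: bal; rewrite [m.+1.-1]/= => /eqP; rewrite addrC addr_eq0 => /eqP bal.
move=> fvE; apply/(addIr (- time_flux theta W m i)).
apply: (scalerI vol0); rewrite /= bal -fvE opprD addrA subrr add0r scalerN.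
by rewrite scalerA mulrCA divff// mulr1.
Qed.

End Galerkin.

#[local] Arguments time_flux : simpl never.

(** * Reduction of the variational form to boundary and volume terms *)

Section BoundaryForm.
Context {R : realType} {d : nat}.
Variables (Omega : set 'rV[R]_d) (T : R) (M : mesh R d).
Hypothesis HM : is_mesh Omega T M.
Variables (F : numflux M) (theta : R) (g : 'rV[R]_d * R -> state R d).
Variables (W : gridfun M) (phi : 'rV[R]_d * R -> state R d).
Local Notation phib := (fun (_ : cell M) (_ : nat) => phi).
Hypothesis okphi : Nform_ok F theta g W phib.
Implicit Types (i : cell M) (e : face M) (m : nat).

(** Both cells at an interior face are tested with the same function [phi], and conservativity makes
    their fluxes opposite. *)
Lemma interior_faces_cancel m : conservative F -> (0 < m <= lvl M)%N ->
  \sum_i \sum_(e | inc i e) \int[stsurf]_(p in face_set e `*` slab M m)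
     dots (face_flux F g W m i e) (phi p)
  = \sum_i \sum_(e | is_bdry_face e && inc i e)
      \int[stsurf]_(p in face_set e `*` slab M m)
        dots (face_flux F g W m i e) (phi p).
Proof.
move=> cons mN.
under eq_bigr => i _ do rewrite (bigID (@is_bdry_face R d M)) /=.
rewrite big_split /= [X in _ + X](_ : _ = 0) ?addr0.
  by apply: eq_bigr => i _; apply: eq_bigl => e; rewrite andbC.
rewrite (exchange_big_dep (fun e => ~~ is_bdry_face e)); last first.
  by move=> i e _ /andP[].
apply: big1 => e nbe.
(* A face has one or two cells; one that is not a boundary face has exactly two. *)
have /cards2P[i [j [ij A]]] : #|[set i | inc i e]%SET| == 2%N.
  rewrite cardsE eqn_leq; have /andP[c0 ->] := mesh_inc HM e.
  by move: nbe; rewrite /is_bdry_face neq_ltn ltnNge c0.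
have incE k : inc k e = (k \in [set i; j]%SET) by rewrite -A inE.
have ie : inc i e by rewrite incE !inE eqxx.
have je : inc j e by rewrite incE !inE eqxx orbT.
rewrite (eq_bigl (mem [set i; j]%SET)) => [|k]; last first.
  by rewrite /= nbe andbT incE.
rewrite big_setU1 ?inE//= big_set1.
have [/(_ e ie) oki _ _ _ _] := okphi i mN.
have [/(_ e je) okj _ _ _ _] := okphi j mN.
rewrite -RintegralD_ok//; apply: Rintegral_ae0; apply: filterE => p _.
by rewrite /face_flux (negbTE nbe) (cons _ _ _ _ _ ij ie je) dotsNl addNr.
Qed.

(** The bottom of a slab carries minus the time flux on top of the slab below. The two surviving end
    terms become grid values by [time_fluxE], for any [theta]. *)
Lemma time_fluxes_telescope i : galerkin F theta g W -> fv_scheme F g W ->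
  \sum_(m < lvl M)
    (\int[leb]_(x in cell_set i)
       dots (time_flux theta W m.+1 i) (phi (x, tm M m.+1))
     + \int[leb]_(x in cell_set i)
       dots (- time_flux theta W m i) (phi (x, tm M m)))
  = \int[leb]_(x in cell_set i) dots (W i (lvl M)) (phi (x, T))
    + \int[leb]_(x in cell_set i) dots (- W i 0%N) (phi (x, 0)).
Proof.
move=> gal fv.
pose G m : R := \int[leb]_(x in cell_set i)
  dots (time_flux theta W m i) (phi (x, tm M m)).
have GN m : (m < lvl M)%N -> \int[leb]_(x in cell_set i)
    dots (- time_flux theta W m i) (phi (x, tm M m)) = - G m.
  move=> mN; have mN' : (0 < m.+1 <= lvl M)%N by [].
  have [_ _ okb _ _] := okphi i mN'.
  apply: oppr_inj; rewrite opprK -RintegralN_ok//.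
  by apply: eq_Rintegral => x _; rewrite dotsNl opprK.
transitivity (\sum_(m < lvl M) (G m.+1 - G m)).
  by apply: eq_bigr => -[m mN] _; rewrite /= GN.
rewrite -(big_mkord xpredT (fun m => G m.+1 - G m)) telescope_sumr//.
rewrite -GN ?(mesh_lvl HM)// /G (time_fluxE HM okphi)// (mesh_tN HM).
by rewrite (mesh_t0 HM).
Qed.

Lemma Nform_boundary :
  conservative F -> galerkin F theta g W -> fv_scheme F g W ->
  Nform F theta g W phib
  = \sum_i \sum_(m < lvl M) \sum_(e | is_bdry_face e && inc i e)
      \int[stsurf]_(p in face_set e `*` slab M m.+1)
        dots (face_flux F g W m.+1 i e) (phi p)
    + \sum_i \int[leb]_(x in cell_set i) dots (W i (lvl M)) (phi (x, T))
    + \sum_i \int[leb]_(x in cell_set i) dots (- W i 0%N) (phi (x, 0))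
    - \sum_i \sum_(m < lvl M)
        (\int[stvol]_(p in cell_set i `*` slab M m.+1)
           dots (W i m.+1) ('D_dirt phi p)
         + \int[stvol]_(p in cell_set i `*` slab M m.+1)
             flux_grad (W i m.+1) phi p).
Proof.
move=> cons gal fv; rewrite NformE /cell_form /=.
under eq_bigr do rewrite sumrB.
rewrite sumrB; congr (_ - _).
rewrite [X in _ = X + _ + _](_ : _ = \sum_i \sum_(m < lvl M)
    \sum_(e | inc i e) \int[stsurf]_(p in face_set e `*` slab M m.+1)
      dots (face_flux F g W m.+1 i e) (phi p)); last first.
  rewrite exchange_big [RHS]exchange_big; apply: eq_bigr => -[m mN] _ /=.
  by rewrite interior_faces_cancel.
rewrite -!big_split; apply: eq_bigr => i _ /=.
rewrite !big_split /= -addrA -big_split /=.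
by rewrite (time_fluxes_telescope i gal fv) addrA.
Qed.

End BoundaryForm.

(** * Linearity of the space-time boundary integral *)

Section BoundaryIntegral.
Context {R : realType} {d : nat}.
Variables (Omega : set 'rV[R]_d) (T : R) (n : 'rV[R]_d -> 'rV[R]_d).
Implicit Types h k : 'rV[R]_d * R -> 'rV[R]_d * R -> R.

Lemma bd_int_okD h k : bd_int_ok Omega T n h -> bd_int_ok Omega T n k ->
  bd_int_ok Omega T n (fun p nu => h p nu + k p nu).
Proof. by move=> [? ? ?] [? ? ?]; split; exact: integral_okD. Qed.

Lemma bd_int_okB h k : bd_int_ok Omega T n h -> bd_int_ok Omega T n k ->
  bd_int_ok Omega T n (fun p nu => h p nu - k p nu).
Proof. by move=> [? ? ?] [? ? ?]; split; exact: integral_okB. Qed.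

Lemma bd_intD h k : bd_int_ok Omega T n h -> bd_int_ok Omega T n k ->
  bd_int Omega T n (fun p nu => h p nu + k p nu)
  = bd_int Omega T n h + bd_int Omega T n k.
Proof.
by move=> [? ? ?] [? ? ?]; rewrite /bd_int !RintegralD_ok//; ring.
Qed.

Lemma bd_intB h k : bd_int_ok Omega T n h -> bd_int_ok Omega T n k ->
  bd_int Omega T n (fun p nu => h p nu - k p nu)
  = bd_int Omega T n h - bd_int Omega T n k.
Proof.
by move=> [? ? ?] [? ? ?]; rewrite /bd_int !RintegralB_ok//; ring.
Qed.

End BoundaryIntegral.

(** * Volume and boundary contributions to the error *)

Section ErrorIdentity.
Context {R : realType} {d : nat}.
Variables (Omega : set 'rV[R]_d) (T : R) (M : mesh R d).
Hypothesis HM : is_mesh Omega T M.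
Variables (F : numflux M) (theta : R) (U Up g : 'rV[R]_d * R -> state R d).
Variables (W : gridfun M) (phi : 'rV[R]_d * R -> state R d).
Local Notation n := (bdry_normal M).
Local Notation Uh := (gridfun_val W).
Local Notation phib := (fun (_ : cell M) (_ : nat) => phi).
Hypothesis okphi : Nform_ok F theta g W phib.

(** The adjoint equation is paired with [u - v]; moving the transposed matrices to the other factor
    produces flux differences, and all terms in [u] cancel. *)
Lemma adjoint_flux_difference (u v phit psi : state R d)
    (Dphi : 'I_d -> state R d) :
  0 < density u -> 0 < density v ->
  phit + \sum_k (avg_jac k u v)^T *m Dphi k = psi ->
  dots u phit + \sum_k dots (flux k u) (Dphi k) - (dots u psi - dots v psi)
  = dots v phit + \sum_k dots (flux k v) (Dphi k).
Proof.
move=> u0 v0 <-; rewrite -dotsBl dotsDr dots_sumr.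
under [X in _ - (_ + X)]eq_bigr do rewrite dots_trmx avg_jac_mul// dotsBl.
by rewrite sumrB dotsBl; ring.
Qed.

Lemma volume_error (psi : 'rV[R]_d * R -> state R d) :
  cyl_ae Omega T (fun p => 0 < density (U p)) ->
  (forall i m, (0 < m <= lvl M)%N -> 0 < density (W i m)) ->
  cyl_ae Omega T (fun p => 'D_dirt phi p
    + \sum_k (avg_jac k (U p) (Uh p))^T *m 'D_(dirx k) phi p = psi p) ->
  cyl_int_ok Omega T (fun p => dots (U p) ('D_dirt phi p)) ->
  cyl_int_ok Omega T (fun p => flux_grad (U p) phi p) ->
  cyl_int_ok Omega T (fun p => dots (U p) (psi p)) ->
  cyl_int_ok Omega T (fun p => dots (Uh p) (psi p)) ->
  cyl_int Omega T (fun p => dots (U p) ('D_dirt phi p))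
  + cyl_int Omega T (fun p => flux_grad (U p) phi p)
  - (cyl_int Omega T (fun p => dots (U p) (psi p))
     - cyl_int Omega T (fun p => dots (Uh p) (psi p)))
  = \sum_i \sum_(m < lvl M)
      (\int[stvol]_(p in cell_set i `*` slab M m.+1)
         dots (W i m.+1) ('D_dirt phi p)
       + \int[stvol]_(p in cell_set i `*` slab M m.+1)
           flux_grad (W i m.+1) phi p).
Proof.
move=> Upos Wpos adj okt okx okU okUh; rewrite /cyl_int.
(* The adjoint equation acts pointwise, so the four integrals are merged before the cylinder is cut.
   The terms in [Uh] are separated only inside single cells, where their integrability is given. *)
rewrite -RintegralD_ok// -RintegralB_ok//.
rewrite -RintegralB_ok; [|exact: integral_okD|exact: integral_okB].
rewrite pair_bigA /=.
have okW (im : cell M * 'I_(lvl M)) :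
    integral_ok stvol (cell_set im.1 `*` slab M im.2.+1)
      (fun p => dots (W im.1 im.2.+1) ('D_dirt phi p)) /\
    integral_ok stvol (cell_set im.1 `*` slab M im.2.+1)
      (fun p => flux_grad (W im.1 im.2.+1) phi p).
  have mN : (0 < im.2.+1 <= lvl M)%N by exact: ltn_ord.
  by have [_ _ _ ? ?] := okphi im.1 mN.
under [RHS]eq_bigr => im _.
  have [okWt okWx] := okW im.
  rewrite -RintegralD_ok//.
  over.
apply: (@Rintegral_pieces _ _ _ (@stvol R d) _ _ _ predT
  (fun im : cell M * 'I_(lvl M) => cell_set im.1 `*` slab M im.2.+1)
  (fun im p => dots (W im.1 im.2.+1) ('D_dirt phi p)
               + flux_grad (W im.1 im.2.+1) phi p)).
- by apply: integral_okB; [exact: integral_okD|exact: integral_okB].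
- by move=> im _; have [? ?] := okW im; exact: integral_okD.
rewrite /cyl_ae in Upos adj.
apply: filterS3 (cyl_cells_ae HM) Upos adj => p [cylp pcyl] Up0 adjp.
split=> [/[dup] cp /cylp[im]|im _ [cim sim]]; last exact: pcyl cim sim.
move=> [cim sim uni WE]; exists im; split=> [||jn _ []|].
- by [].
- by [].
- exact: uni.

rewrite /flux_grad -WE; apply: adjoint_flux_difference.
- exact: Up0.
- by rewrite WE; apply: Wpos; exact: ltn_ord.
- exact: adjp.
Qed.

Lemma boundary_error :
  galerkin F theta g W -> fv_scheme F g W ->
  bd_int_ok Omega T n (fun p nu => dots (outflow nu (Uh p)) (phi p)
                                   + dots (Pm nu (Uh p) *m g p) (phi p)) ->
  bd_int Omega T n (fun p nu => dots (outflow nu (Uh p)) (phi p)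
                                + dots (Pm nu (Uh p) *m g p) (phi p))
  = \sum_i \sum_(m < lvl M) \sum_(e | is_bdry_face e && inc i e)
      \int[stsurf]_(p in face_set e `*` slab M m.+1)
        dots (face_flux F g W m.+1 i e) (phi p)
    + \sum_i \int[leb]_(x in cell_set i) dots (W i (lvl M)) (phi (x, T))
    + \sum_i \int[leb]_(x in cell_set i) dots (- W i 0%N) (phi (x, 0))
    + data_oscillation g W phi.
Proof.
move=> gal fv [okl okT ok0]; rewrite /bd_int.
have mN m : (m < lvl M)%N -> (0 < m.+1 <= lvl M)%N by [].
(* On lateral faces the scheme carries the average of [g]; the difference between [g] and this
   average, filtered by [Pm], is the oscillation. *)
have -> : \int[stsurf]_(p in lateral Omega T)
      (dots (outflow (n p.1, 0) (Uh p)) (phi p)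
       + dots (Pm (n p.1, 0) (Uh p) *m g p) (phi p))
    = \sum_i \sum_(m < lvl M) \sum_(e | is_bdry_face e && inc i e)
        \int[stsurf]_(p in face_set e `*` slab M m.+1)
          dots (face_flux F g W m.+1 i e) (phi p)
    + \sum_i \sum_(1 <= m < (lvl M).+1) \sum_(e | is_bdry_face e && inc i e)
        \int[stsurf]_(p in face_set e `*` slab M m)
          dots (Pm (nrm i e, 0) (W i m) *m (g p - face_avg g e m)) (phi p).
  under [X in _ = _ + X]eq_bigr do rewrite big_add1 big_mkord.
  rewrite !pair_bigA !pair_big_dep /=.
  apply: (@Rintegral_pieces_split _ _ _ (@stsurf R d) _ _ _
    (fun ime : cell M * 'I_(lvl M) * face M =>
       is_bdry_face ime.2 && inc ime.1.1 ime.2)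
    (fun ime => face_set ime.2 `*` slab M ime.1.2.+1)
    (fun ime p => dots (face_flux F g W ime.1.2.+1 ime.1.1 ime.2) (phi p))
    (fun ime p => dots (Pm (nrm ime.1.1 ime.2, 0) (W ime.1.1 ime.1.2.+1)
       *m (g p - face_avg g ime.2 ime.1.2.+1)) (phi p))) => //.
    move=> [[i m] e] /= /andP[_ ie].
    by have [/(_ e ie)] := okphi i (mN _ (ltn_ord m)).
  apply: filterS (lateral_faces_ae HM) => p [latp platp]; split=> //.
  move=> /latp[ime [bie pime uni [WE nE]]]; exists ime; split=> //.
  rewrite WE nE /face_flux; have /andP[-> _] := bie.
  by rewrite dotsDl mulmxBr dotsBl; ring.
(* On the top [Pm] vanishes and [outflow] is the identity: the last level appears and no data
   enter. *)
have -> : \int[leb]_(x in Omega)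
      (dots (outflow (0, 1) (Uh (x, T))) (phi (x, T))
       + dots (Pm (0, 1) (Uh (x, T)) *m g (x, T)) (phi (x, T)))
    = \sum_i \int[leb]_(x in cell_set i) dots (W i (lvl M)) (phi (x, T)).
  apply: (@Rintegral_pieces _ _ _ (@leb R d) _ _ _ predT (@cell_set R d M)
    (fun i x => dots (W i (lvl M)) (phi (x, T)))) => //.
    move=> i _; have N0 : (0 < lvl M <= lvl M)%N by rewrite (mesh_lvl HM) leqnn.
    have [_ + _ _ _] := okphi i N0.
    by rewrite (time_fluxE HM okphi i gal fv (leqnn _)) (mesh_tN HM).
  apply: filterS (base_cells_ae HM) => x [Ox xO]; split=> [/Ox[i]|i _].
    2: exact: xO.
  move=> [ix uni WT _]; exists i; split=> // [j _|]; first exact: uni.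
  by rewrite outflow_top Pm_top mul0mx dots0l addr0 WT.
(* On the bottom [Pm] is the identity and the outflow vanishes, so the exact datum is [g] and that
   of the scheme is [- W i 0]; they differ by [g + W i 0]. *)
have -> : \int[leb]_(x in Omega)
      (dots (outflow (0, -1) (Uh (x, 0))) (phi (x, 0))
       + dots (Pm (0, -1) (Uh (x, 0)) *m g (x, 0)) (phi (x, 0)))
    = \sum_i \int[leb]_(x in cell_set i) dots (- W i 0%N) (phi (x, 0))
    + \sum_i \int[leb]_(x in cell_set i)
        dots (Pm (0, -1) (W i 1%N) *m (g (x, 0) + W i 0%N)) (phi (x, 0)).
  apply: (@Rintegral_pieces_split _ _ _ (@leb R d) _ _ _ predT (@cell_set R d M)
    (fun i x => dots (- W i 0%N) (phi (x, 0)))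
    (fun i x => dots (Pm (0, -1) (W i 1%N) *m (g (x, 0) + W i 0%N))
                  (phi (x, 0)))) => //.
    move=> i _; have [_ _ + _ _] := okphi i (mN _ (mesh_lvl HM)).
    by rewrite /= (mesh_t0 HM).
  apply: filterS (base_cells_ae HM) => x [Ox xO]; split=> [/Ox[i]|i _].
    2: exact: xO.
  move=> [ix uni _ W0]; exists i; split=> // [j _|]; first exact: uni.
  rewrite outflow_bottom !Pm_bottom !mul1mx dots0l add0r.
  by rewrite dotsDl dotsNl; ring.
rewrite /data_oscillation -!addrA; congr (_ + _); rewrite addrCA.
by congr (_ + _); rewrite addrCA.
Qed.

Lemma data_resolved_oscillation :
  data_resolved g W -> data_oscillation g W phi = 0.
Proof.
move=> [gavg g0]; rewrite /data_oscillation big1 => [|i _]; last first.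
  rewrite big_nat big1// => m mN; rewrite big1// => e /andP[be _].
  apply: Rintegral_ae0; have mN' : (0 < m <= lvl M)%N by rewrite -ltnS.
  apply: filterS (gavg e m be mN') => p gp /gp ->.
  by rewrite subrr mulmx0 dots0l.
rewrite add0r big1// => i _; apply: Rintegral_ae0.
by apply: filterS (g0 i) => x gx /gx ->; rewrite addNr mulmx0 dots0l.
Qed.

End ErrorIdentity.

(** Here [a], [b] are the outflow fluxes of [U] and [Uh], [Pa], [Pb] their inflow data, [f] is the
    adjoint solution and [q] the boundary weight of the functional. *)
Lemma boundary_densities {R : realType} {d : nat} (a b Pa Pb f q : state R d) :
  dots b f + dots Pb f
  = dots a f + dots Pa f - (dots a q - dots b q)
    - (dots (Pa - Pb) f + dots (a - b) (f - q)).
Proof. by rewrite !dotsBl !dotsBr; ring. Qed.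

(** The first hypothesis is the weak formulation; in the second, the left side is the boundary
    integral of [Uh] expressed through [U], the right side the boundary form of the scheme plus the
    oscillation. *)
Lemma error_arithmetic {R : realType}
    (cU cV UG VG em ep At Ax out pm bd osc : R) :
  At + Ax - out = pm -> out + pm - (UG - VG) - (em + ep) = bd + osc ->
  cU - UG - (cV - VG) + - em + - ep = bd - (At + Ax - (cU - cV)) + osc.
Proof.
move=> weak bdE; have -> : bd = out + pm - (UG - VG) - (em + ep) - osc.
  by rewrite bdE addrK.
by rewrite -weak; ring.
Qed.

Theorem theorem3p1 (R : realType) (d : nat)
    (Omega : set 'rV[R]_d) (T : R) (M : mesh R d)
    (theta : R) (F : numflux M)
    (U Up g : 'rV[R]_d * R -> state R d) (W : gridfun M)
    (psi psiG phi : 'rV[R]_d * R -> state R d) :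
  let n := bdry_normal M in
  let Uh := gridfun_val W in
  let N := Nform F theta g W in
  let phib : broken M := fun _ _ => phi in
  let epsJ := functional Omega T n psi psiG U Up
              - functional Omega T n psi psiG Uh Uh in
  let eps_minus := - bd_int Omega T n (err_minus_density Up Uh g phi) in
  let eps_plus := - bd_int Omega T n (err_plus_density Up Uh phi psiG) in
  let eta := N phib in
  (0 < d)%N -> 0 < T -> open Omega -> is_mesh Omega T M ->
  0 <= theta <= 1 -> conservative F -> consistent F ->
  weak_solution Omega T n U Up g ->
  admissible Omega T n U Up ->
  initial_averages g W ->
  (forall i m, (0 < m <= lvl M)%N -> 0 < density (W i m)) ->
  fv_scheme F g W ->
  galerkin F theta g W ->
  diagonalizable_normals Omega T n Up Uh ->
  test_space Omega T phi ->
  adjoint_solution Omega T n U Up Uh Uh psi psiG phi ->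
  functional_ok Omega T n psi psiG U Up ->
  functional_ok Omega T n psi psiG Uh Uh ->
  bd_int_ok Omega T n (err_minus_density Up Uh g phi) ->
  bd_int_ok Omega T n (err_plus_density Up Uh phi psiG) ->
  Nform_ok F theta g W phib ->
  [/\ data_resolved g W -> epsJ + eps_minus + eps_plus = eta,
      epsJ + eps_minus + eps_plus = eta + data_oscillation g W phi
    & forall phi_h : gridfun M,
        eta = N (fun i m p => phib i m p - cst_broken phi_h i m p)].
Proof.
move=> n Uh N phib epsJ eps_minus eps_plus eta _ _ _ HM _ cons _ wU [Upos _] _.
move=> Wpos fv gal _ tphi [adj _] [okU okUG] [okUh okUhG] okm okp okN.
have [_ _ /(_ phi tphi)[okt okx okout okPm weak]] := wU.
pose k (p nu : 'rV[R]_d * R) := dots (outflow nu (Uh p)) (phi p)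
                              + dots (Pm nu (Uh p) *m g p) (phi p).
pose k1 (p nu : 'rV[R]_d * R) := dots (outflow nu (Up p)) (phi p)
                               + dots (Pm nu (Up p) *m g p) (phi p).
pose k2 (p nu : 'rV[R]_d * R) := dots (outflow nu (Up p)) (psiG p)
                               - dots (outflow nu (Uh p)) (psiG p).
pose k3 (p nu : 'rV[R]_d * R) := err_minus_density Up Uh g phi p nu
                               + err_plus_density Up Uh phi psiG p nu.
have kE : k = fun p nu => k1 p nu - k2 p nu - k3 p nu.
  apply/funext => p; apply/funext => nu.
  rewrite /k /k1 /k2 /k3 /err_minus_density /err_plus_density mulmxBl.
  exact: boundary_densities.
have ok1 : bd_int_ok Omega T n k1 by exact: bd_int_okD.
have ok2 : bd_int_ok Omega T n k2 by exact: bd_int_okB.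
have ok3 : bd_int_ok Omega T n k3 by exact: bd_int_okD.
have ok12 : bd_int_ok Omega T n (fun p nu => k1 p nu - k2 p nu).
  exact: bd_int_okB.
(* The boundary integrand of [Uh] inherits integrability from the weak formulation, the two
   functionals and the error densities through [kE]. *)
have okk : bd_int_ok Omega T n k by rewrite kE; exact: bd_int_okB.
have kint : bd_int Omega T n k
    = bd_int Omega T n k1 - bd_int Omega T n k2 - bd_int Omega T n k3.
  by rewrite kE bd_intB// bd_intB.
have bdE := boundary_error HM okN gal fv okk.
have volE := volume_error HM okN Upos Wpos adj okt okx okU okUh.
have main : epsJ + eps_minus + eps_plus = eta + data_oscillation g W phi.
  (* The volume sum in [eta] is replaced by integrals of [U] and the functional weights, the face
     sums by the boundary integral of [k]; scalar arithmetic remains. *)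
  rewrite /eta /N (Nform_boundary HM okN cons gal fv) -volE.
  apply: error_arithmetic; first exact: weak.
  rewrite -bdE -[RHS]/(bd_int Omega T n k) kint.
  by rewrite /k1 /k2 /k3 bd_intD// bd_intB// bd_intD.
split=> [/(data_resolved_oscillation phi) osc0||c].
- by rewrite main osc0 addr0.
- exact: main.
- by rewrite /eta /N (Nform_cstB HM okN) gal subr0.
Qed.
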